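(* Let $\lambda$ be an uncountable cardinal and let $\theta=\mathrm{cf}(\theta)\le\lambda$ be a regular cardinal. Let $$\Theta_\lambda=\Theta_{\lambda,\theta}=\{\mathrm{cf}(\lambda),\theta\},$$ except when $\lambda=\mu^+$ with $\mu>\mathrm{cf}(\mu)$, in which case $\Theta_\lambda=\{\mathrm{cf}(\lambda),\mathrm{cf}(\mu),\theta\}$. Let $$\Theta'_\lambda=\{\sigma<\lambda:\sigma=\mathrm{cf}(\sigma)\text{ and }\lambda^{\langle\lambda;\sigma\rangle}=\lambda\}.$$ If $G$ is a locally finite group of cardinality $\lambda$, then there is a locally finite group $H$ of cardinality $\lambda$ extending $G$ which is $(\Theta'_\lambda\setminus\Theta_\lambda)$-indecomposable.
   Context: A group is locally finite if each finitely generated subgroup is finite. For a regular (infinite) cardinal $\sigma$, a group $M$ is $\sigma$-indecomposable if for every $\subseteq$-increasing sequence $\langle M_i:i<\sigma\rangle$ of subgroups with union $M$ we have $M=M_i$ for some $i<\sigma$. For a set $\Theta$ of regular cardinals, $M$ is $\Theta$-indecomposable if it is $\sigma$-indecomposable for every $\sigma\in\Theta$. For cardinals $\lambda\ge\theta\ge\sigma$, $\lambda^{\langle\theta;\sigma\rangle}$ is the minimal cardinality $|\mathcal{P}|$ of a family $\mathcal{P}\subseteq[\lambda]^\sigma$ such that for every $u\in[\lambda]^\theta$ there is $v\in[u]^\sigma$ which belongs to $\mathcal{P}$. Here $[A]^\sigma$ is the set of subsets of $A$ of cardinality $\sigma$. *)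

(* Defs.v *)
From mathcomp Require Import all_boot.
From mathcomp Require Import boolp classical_sets functions cardinality wochoice.

Set Implicit Arguments.
Unset Strict Implicit.
Unset Printing Implicit Defensive.

Local Open Scope classical_set_scope.
Local Open Scope card_scope.

(* Cardinals are initial ordinals: well-ordered types no proper initial segment
   of which is equinumerous to the whole type.  The elements of kappa : cardinal
   are the ordinals i < kappa, and cardinal_le is their (reflexive) order.
   Cardinals are compared up to #=, never by Leibniz equality. *)
Record cardinal := Cardinal {
  cardinal_sort :> choiceType;
  cardinal_le : rel cardinal_sort;
  cardinal_wo : well_order cardinal_le;
  cardinal_initial : forall x : cardinal_sort,
    ~~ ([set: cardinal_sort] #<= [set y | cardinal_le y x /\ y <> x])
}.

Definition card_lt (kappa lambda : cardinal) : Prop :=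
  [set: kappa] #<= [set: lambda] /\ ~~ ([set: lambda] #<= [set: kappa]).

Definition is_succ_card (lambda mu : cardinal) : Prop :=
  card_lt mu lambda /\
  forall kappa : cardinal, card_lt mu kappa -> [set: lambda] #<= [set: kappa].

(* kappa is the minimum of the cardinalities |A|, for A in the family C. *)
Definition is_min_card (T : Type) (C : set T -> Prop) (kappa : cardinal) :
    Prop :=
  (exists2 A, C A & A #= [set: kappa]) /\
  (forall A, C A -> [set: kappa] #<= A).

Definition cofinal (lambda : cardinal) (A : set lambda) : Prop :=
  forall x : lambda, exists2 y, A y & cardinal_le x y.

(* kappa = cf(lambda) *)
Definition is_cf (kappa lambda : cardinal) : Prop :=
  is_min_card (@cofinal lambda) kappa.

Definition regular (sigma : cardinal) : Prop :=
  infinite_set [set: sigma] /\ is_cf sigma sigma.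

(* mu > cf(mu) *)
Definition singular (mu : cardinal) : Prop :=
  exists2 kappa : cardinal, is_cf kappa mu & card_lt kappa mu.

(* [A]^sigma *)
Definition subsets_of_card (T : Type) (A : set T) (sigma : cardinal) :
    set (set T) :=
  [set u | u `<=` A /\ u #= [set: sigma]].

Definition covering_family (lambda theta sigma : cardinal)
    (P : set (set lambda)) : Prop :=
  P `<=` subsets_of_card [set: lambda] sigma /\
  forall u, subsets_of_card [set: lambda] theta u ->
    exists2 v, subsets_of_card u sigma v & P v.

(* kappa = lambda^<theta; sigma> *)
Definition is_covering_number (kappa lambda theta sigma : cardinal) : Prop :=
  is_min_card (@covering_family lambda theta sigma) kappa.

(* Sets of cardinals are predicates on cardinal rather than elements of
   set cardinal, which lives in a higher universe. *)
Definition Theta (lambda theta sigma : cardinal) : Prop :=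
  [\/ is_cf sigma lambda,
      [set: sigma] #= [set: theta]
    | exists mu : cardinal,
        [/\ is_succ_card lambda mu, singular mu & is_cf sigma mu]].

Definition Theta' (lambda sigma : cardinal) : Prop :=
  [/\ card_lt sigma lambda, regular sigma
    & is_covering_number lambda lambda lambda sigma].

Definition subgroup (G : groupType) (A : set G) : Prop :=
  group_closed [in A].

Definition locally_finite (G : groupType) : Prop :=
  forall A : set G, finite_set A -> finite_set (smallest (@subgroup G) A).

Definition indecomposable (sigma : cardinal) (G : groupType) : Prop :=
  forall M : sigma -> set G,
    (forall i, subgroup (M i)) ->
    (forall i j, cardinal_le i j -> M i `<=` M j) ->
    \bigcup_i M i = [set: G] ->
    exists i, M i = [set: G].

Definition set_indecomposable (S : cardinal -> Prop) (G : groupType) : Prop :=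
  forall sigma : cardinal, S sigma -> indecomposable sigma G.

(* Main.v *)
(* Every operation used on lambda is read off walks.  Fix injections e_b of the
   predecessors of b into |b|, and walk from b down to a by moving to the point
   c of [a, b) with e_b(c) minimal.  Let mu be regular, N unbounded in mu^+, and d
   a limit of N of cofinality mu.  For a in N close below d, the walk from any b
   above d to a passes through d, and d is its first point whose next step has
   weight at least m, for all large m < mu; such an m occurs as e_b'(a') with a',
   b' in N.  Composing with an Ulam-type guessing function, a fixed operation in
   boundedly many variables thus maps N onto mu.  If lambda is the union of an
   increasing sigma-chain, some member of the chain is unbounded in mu^+; running
   through all regular mu, one operation O on six variables maps some member of
   the chain onto lambda, unless sigma is cf(lambda) or the cofinality of a
   singular cardinal predecessor of lambda.

   The group H consists of permutations of a product of registers indexed by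
   theta, over a base on which G acts.  Its generators are involutions, and each
   level acts only where all higher registers are empty.  At every level there
   are involutions indexed by lambda such that those with indices x_1, ..., x_6
   generate, together with four fixed ones and by commutators, the lower generator
   numbered O(x_1, ..., x_6).  So a sigma-chain of subgroups with union H has, for
   each level, a member containing everything below, and sigma <> theta does the
   rest.  A finite set of generators has finite orbits of bounded size, whence H
   is locally finite.  That G itself lies in a group generated by involutions
   uses that its elements have finite order: g = g^-(n-1) is spread over n
   residue classes. *)
From HB Require Import structures.
Require Import Defs.
From mathcomp Require Import all_boot all_order.
From mathcomp Require Import boolp classical_sets functions cardinality wochoice.

Set Implicit Arguments.
Unset Strict Implicit.
Unset Printing Implicit Defensive.

Import Order.TTheory.

Local Open Scope classical_set_scope.
Local Open Scope card_scope.
Local Open Scope order_scope.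

(** * Cardinalities of well-ordered sets *)

Lemma inj_card_leP T U (u0 : U) (A : set T) (B : set U) :
  A #<= B <-> exists f : T -> U,
    (forall x, A x -> B (f x)) /\
    (forall x y, A x -> A y -> f x = f y -> x = y).
Proof.
split=> [/card_leP[f]|[f [fAB finj]]].
  exists (fun x => if pselect (x \in A) is left xA then val (f (SigSub xA)) else u0).
  split=> [x Ax|x y Ax Ay].
    case: pselect => [xA|]; last by rewrite mem_set.
    exact: set_mem (valP (f _)).
  case: pselect => [xA|]; last by rewrite mem_set.
  case: pselect => [yA|]; last by rewrite mem_set.
  move=> /val_inj /inj; rewrite !in_setT => /(_ isT isT).
  by move=> /(congr1 val).
apply: (@card_le_trans _ _ _ (f @` A)).
  have/card_esym/card_eqPle[//] : f @` A #= A.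
  by apply: inj_card_eq => x y /set_mem Ax /set_mem Ay; apply: finj.
by apply: subset_card_le => _ [x Ax <-]; apply: fAB.
Qed.

Lemma card_le_inj T U (A : set T) (B : set U) (f : T -> U) :
  (forall x, A x -> B (f x)) ->
  (forall x y, A x -> A y -> f x = f y -> x = y) -> A #<= B.
Proof.
move=> fAB finj; have [[x Ax]|/set0P/negP/negPn/eqP->] := pselect (A !=set0) => //.
by apply/(inj_card_leP (f x)); exists f.
Qed.

Lemma card_le_surj T U (A : set T) (B : set U) (f : T -> U) :
  (forall y, B y -> exists2 x, A x & f x = y) -> B #<= A.
Proof.
move=> fB; apply: (@card_le_trans _ _ _ (f @` A)); last exact: card_image_le.
by apply: subset_card_le => y /fB[x Ax <-]; exists x.
Qed.

Lemma card_leX T U T' U' (A : set T) (B : set U) (A' : set T') (B' : set U') :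
  A #<= A' -> B #<= B' -> A `*` B #<= A' `*` B'.
Proof.
move=> AA' BB'.
have [[[x y] [/= Ax By]]|/set0P/negP/negPn/eqP->] := pselect ((A `*` B) !=set0) => //.
have [x' A'x'] : A' !=set0.
  by apply/set0P; apply: contraPneq AA' => ->; rewrite card_le0 => /eqP A0; rewrite A0 in Ax.
have [y' B'y'] : B' !=set0.
  by apply/set0P; apply: contraPneq BB' => ->; rewrite card_le0 => /eqP A0; rewrite A0 in By.
have /(inj_card_leP x')[f [fA finj]] := AA'.
have /(inj_card_leP y')[g [gA ginj]] := BB'.
apply: (@card_le_inj _ _ _ _ (fun z => (f z.1, g z.2))).
  by move=> [a b] [/= ? ?]; split; [apply: fA|apply: gA].
by move=> [a b] [a2 b2] [/= ? ?] [/= ? ?] [/finj-> // /ginj->].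
Qed.

Lemma infinite_card_le T U (A : set T) (B : set U) :
  infinite_set A -> A #<= B -> infinite_set B.
Proof. by move=> iA AB fB; apply: iA; apply: card_le_finite AB fB. Qed.


(** Hilbert's hotel: [g] sends [x] to the start of an embedded copy of the naturals in [A] and
    shifts that copy by one. *)
Lemma infinite_setU1_card_le T (A : set T) x :
  infinite_set A -> A `|` [set x] #<= A.
Proof.
move=> /infiniteP/(inj_card_leP x)[f [fA finj]].
have [Ax|nAx] := pselect (A x).
  by apply: subset_card_le => y [//|->].
pose g y := if pselect (y = x) is left _ then f 0%N
  else if pselect (exists n, y = f n) is left ex then f (projT1 (cid ex)).+1 else y.
have gx : g x = f 0%N by rewrite /g; case: pselect.
have gf n : g (f n) = f n.+1.
  rewrite /g; case: pselect => [fx|_]; first by case: nAx; rewrite -fx; apply: fA.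
  case: pselect => [ex|[]]; last by exists n.
  by case: cid => m /= /finj ->.
have gid y : y <> x -> (forall n, y <> f n) -> g y = y.
  by move=> yx yf; rewrite /g; case: pselect => // _; case: pselect => // -[n e]; case: (yf n e).
have gP y : A y -> (exists n, y = f n /\ g y = f n.+1) \/ g y = y /\ forall n, y <> f n.
  move=> Ay; have [[n ->]|nf] := pselect (exists n, y = f n); first by left; exists n.
  right; have yf n : y <> f n by move=> e; apply: nf; exists n.
  by split=> //; apply: gid => // yx; apply: nAx; rewrite -yx.
apply: (@card_le_inj _ _ _ _ g) => [y [|->]|y z].
- by move=> Ay; case: (gP y Ay) => [[n [_ ->]]|[-> _]] //; apply: fA.
- by rewrite gx; apply: fA.
case=> [Ay|->] [Az|->] //.
- case: (gP y Ay) => [[n [-> ->]]|[-> yf]]; case: (gP z Az) => [[p [-> ->]]|[-> zf]] //.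
  + by move=> e; have [->] := finj _ _ I I e.
  + by move=> e; case: (zf _ (esym e)).
  + by move=> e; case: (yf _ e).
- rewrite gx; case: (gP y Ay) => [[n [-> ->]]|[-> yf]]; first by move=> e; have := finj _ _ I I e.
  by move=> e; case: (yf _ e).
- rewrite gx; case: (gP z Az) => [[n [-> ->]]|[-> yf]]; first by move=> e; have := finj _ _ I I e.
  by move=> e; case: (yf _ (esym e)).
Qed.

Section Comparability.
Context {T : Type} {lt : T -> T -> Prop}.
Hypothesis wf_lt : well_founded lt.

Lemma wf_rec (U : Type) (Phi : forall x, (forall y, lt y x -> U) -> U) :
  exists f : T -> U, forall x, f x = Phi x (fun y _ => f y).
Proof.
exists (Fix wf_lt (fun _ => U) Phi) => x; rewrite Fix_eq // => y f g fg.
by congr Phi; apply/functional_extensionality_dep => z;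
  apply/functional_extensionality_dep => zy; apply: fg.
Qed.

Hypothesis lt_trichotomy : forall x y, [\/ x = y, lt x y | lt y x].

(* Inject [D] into [A] greedily; if this gets stuck at [y], the values taken so
   far exhaust [A]. *)
Lemma card_le_or_initial U (A : set U) (D : set T) :
  D #<= A \/ exists2 y, D y & A #<= D `&` [set x | lt x y].
Proof.
have [[u0 Au0]|/set0P/negP/negPn/eqP A0] := pselect (A !=set0); last first.
  have [[y Dy]|/set0P/negP/negPn/eqP->] := pselect (D !=set0); last by left.
  by right; exists y => //; rewrite A0.
pose fresh (f : T -> U) x := [set u | A u /\ forall y, lt y x -> D y -> f y <> u].
have [f fE] := @wf_rec U (fun x rec =>
  if pselect (exists u, A u /\ forall y (yx : lt y x), D y -> rec y yx <> u)
  is left ex then projT1 (cid ex) else u0).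
have fP x : (exists u, fresh f x u) -> fresh f x (f x).
  by rewrite [f x]fE => ex; case: pselect => // ex'; apply: projT2 (cid ex').
have [stuck|free] := pselect (exists2 x, D x & ~ exists u, fresh f x u).
  right; case: stuck => x Dx nx; exists x => //.
  apply: (@card_le_surj _ _ _ _ f) => u Au.
  apply: contrapT => nu; apply: nx; exists u; split=> // y yx Dy fyu.
  by apply: nu; exists y.
have fD x : D x -> fresh f x (f x).
  by move=> Dx; apply: fP; apply: contrapT => nx; apply: free; exists x.
left; apply: (@card_le_inj _ _ _ _ f) => [x /fD[]//|x y Dx Dy fxy].
have [//|xy|yx] := lt_trichotomy x y.
- by have [_ /(_ x xy Dx)] := fD y Dy.
- by have [_ /(_ y yx Dy)] := fD x Dx; rewrite fxy.
Qed.

End Comparability.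

(** * Well-orders and Hessenberg's theorem on squares *)

Section WellOrder.
Context {d : Order.disp_t} {T : orderType d}.
Hypothesis wfT : well_founded (fun x y : T => x < y).
Implicit Types (x y z m : T) (A D X : set T).

Definition seg x : set T := [set y | y < x].

Definition down_closed D := forall x y, D y -> x <= y -> D x.

(** For a down-closed [D] this says that [D] is an initial ordinal. *)
Definition initial_set D := forall x, D x -> ~ (D #<= seg x).

Lemma wf_ind (P : T -> Prop) :
  (forall x, (forall y, y < x -> P y) -> P x) -> forall x, P x.
Proof. exact: (well_founded_ind wfT). Qed.

Lemma wf_least A x : A x -> exists y, A y /\ forall z, A z -> y <= z.
Proof.
elim/wf_ind: x => x IH Ax.
have [[y [Ay yx]]|nex] := pselect (exists y, A y /\ y < x); first exact: IH Ay.
by exists x; split=> // z Az; rewrite leNgt; apply/negP => zx; apply: nex; exists z.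
Qed.

Lemma seg_sub x y : x <= y -> seg x `<=` seg y.
Proof. by move=> xy z /=; rewrite /seg /= => zx; apply: lt_le_trans xy. Qed.

Lemma seg_down x : down_closed (seg x).
Proof. by move=> y z /= zx yz; apply: le_lt_trans zx. Qed.

Lemma setT_down : down_closed [set: T].
Proof. by []. Qed.

Lemma card_le_or_seg U (A : set U) D :
  D #<= A \/ exists2 y, D y & A #<= D `&` seg y.
Proof.
apply: (card_le_or_initial wfT) => x y.
by case: (ltgtP x y) => [?|?|->]; [constructor 2|constructor 3|constructor 1].
Qed.

(** Gödel's canonical order: the predecessors of a pair lie in the square of any [seg n] with [n]
    above its maximum. *)
Definition goedel_lt (p q : T * T) : Prop :=
  Order.max p.1 p.2 < Order.max q.1 q.2 \/
  Order.max p.1 p.2 = Order.max q.1 q.2 /\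
  (p.1 < q.1 \/ p.1 = q.1 /\ p.2 < q.2).

Lemma goedel_wf : well_founded goedel_lt.
Proof.
suff acc m : forall a b, Order.max a b = m -> Acc goedel_lt (a, b).
  by move=> [a b]; apply: acc.
elim/wf_ind: m => m IHm a; elim/wf_ind: a => a IHa b; elim/wf_ind: b => b IHb abm.
constructor=> -[a' b'] [/= lm|/= [lm [la|[ea lb]]]].
- by apply: IHm (erefl _); rewrite -abm.
- by apply: IHa => //; rewrite lm.
- by rewrite ea in lm *; apply: IHb => //; rewrite lm.
Qed.

Lemma goedel_trichotomy (p q : T * T) :
  [\/ p = q, goedel_lt p q | goedel_lt q p].
Proof.
case: p q => [a b] [a' b']; rewrite /goedel_lt /=.
case: (ltgtP (Order.max a b) (Order.max a' b')) => [lm|lm|em].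
- by constructor 2; left.
- by constructor 3; left.
case: (ltgtP a a') => [la|la|ea].
- by constructor 2; right; split=> //; left.
- by constructor 3; right; split=> //; left.
case: (ltgtP b b') => [lb|lb|eb].
- by constructor 2; right; split=> //; right.
- by constructor 3; right; split=> //; right.
- by constructor 1; rewrite ea eb.
Qed.

Lemma initial_no_max D x : initial_set D -> infinite_set D -> D x ->
  exists2 y, D y & x < y.
Proof.
move=> iD infD Dx; apply: contrapT => nmax; apply: (iD x Dx).
have Dle : D `<=` seg x `|` [set x].
  move=> y Dy; have : y <= x.
    by rewrite leNgt; apply/negP => xy; apply: nmax; exists y.
  by rewrite le_eqVlt => /orP[/eqP->|yx]; [right|left].
apply: card_le_trans (subset_card_le Dle) _; apply: infinite_setU1_card_le => finx.
apply: infD; apply: sub_finite_set Dle _.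
by rewrite finite_setU; split=> //; apply: finite_set1.
Qed.

(** Otherwise the greedy comparison along [goedel_lt] embeds [D] into a proper initial part of its
    square, hence into the square of some [seg n], hence into [seg n]. *)
Let initial_squareW D : down_closed D -> initial_set D -> infinite_set D ->
    (forall x, D x -> infinite_set (seg x) -> seg x `*` seg x #<= seg x) ->
  D `*` D #<= D.
Proof.
move=> dD iD infD sq.
have [//|[[a b] [/= Da Db] Dsmall]] :=
  @card_le_or_initial _ _ goedel_wf goedel_trichotomy _ D (D `*` D).
pose m := Order.max a b; have [n Dn mn] : exists2 n, D n & m < n.
  by apply: initial_no_max => //; rewrite /m; case: (leP a b).
exfalso; apply: (iD n Dn).
have Dn2 : D #<= seg n `*` seg n.
  apply: card_le_trans Dsmall _; apply: subset_card_le => -[a' b'] [_ /= lt'].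
  have : Order.max a' b' <= m by case: lt' => [/ltW|/= [->]].
  by rewrite ge_max => /andP[a'm b'm]; split; apply: le_lt_trans mn.
have infn : infinite_set (seg n).
  by move=> finn; apply: infD; apply: card_le_finite Dn2 _; apply: finite_setX.
by apply: card_le_trans Dn2 _; apply: sq.
Qed.

Lemma seg_square x : infinite_set (seg x) -> seg x `*` seg x #<= seg x.
Proof.
elim/wf_ind: x => x IH infx.
have [[y yx xy]|ini] := pselect (exists2 y, y < x & seg x #<= seg y).
  have infy := infinite_card_le infx xy.
  apply: (card_le_trans (card_leX xy xy)).
  by apply: (card_le_trans (IH y yx infy)); apply: subset_card_le; apply: seg_sub (ltW yx).
apply: initial_squareW => // [|y yx ly]; first exact: seg_down.
by apply: ini; exists y.
Qed.

Lemma initial_square D : down_closed D -> initial_set D -> infinite_set D ->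
  D `*` D #<= D.
Proof. by move=> dD iD infD; apply: initial_squareW => // x _; apply: seg_square. Qed.

End WellOrder.

(** * Walks on successor cardinals *)

Section Walks.
Context {d : Order.disp_t} {T : orderType d}.
Hypothesis wfT : well_founded (fun x y : T => x < y).
Implicit Types (x y z m a b c mu nu : T) (A D N X : set T).

Definition unbounded_in D A := forall y, D y -> exists x, [/\ A x, D x & y < x].

Lemma bounded_in D A : ~ unbounded_in D A ->
  exists2 b, D b & forall x, A x -> D x -> x <= b.
Proof.
move=> nunb; apply: contrapT => nb; apply: nunb => y Dy.
apply: contrapT => nx; apply: nb; exists y => // x Ax Dx.
by rewrite leNgt; apply/negP => yx; apply: nx; exists x.
Qed.

Lemma crd_ex x : exists nu, seg x #<= seg nu /\ forall y, seg x #<= seg y -> nu <= y.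
Proof. by apply: (wf_least wfT (A := [set nu | seg x #<= seg nu])); exact: card_lexx. Qed.

(* the cardinality of the set of predecessors of [x], as an initial ordinal *)
Definition crd x : T := projT1 (cid (crd_ex x)).

Lemma crd_card_le x : seg x #<= seg (crd x).
Proof. by rewrite /crd; case: cid => nu []. Qed.

Lemma crd_min x y : seg x #<= seg y -> crd x <= y.
Proof. by rewrite /crd; case: cid => nu /= [_ numin] /numin. Qed.

Lemma enc_ex x : exists f : T -> T, (forall y, y < x -> f y < crd x) /\
  (forall y z, y < x -> z < x -> f y = f z -> y = z).
Proof.
by have /(inj_card_leP x)[f [fl fi]] := crd_card_le x; exists f.
Qed.

(** The injection e_x used by the walks; its values are the weights of steps from [x]. *)
Definition enc x : T -> T := projT1 (cid (enc_ex x)).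

Lemma enc_lt x y : y < x -> enc x y < crd x.
Proof. by rewrite /enc; case: cid => f /= [flt _] /flt. Qed.

Lemma enc_inj x y z : y < x -> z < x -> enc x y = enc x z -> y = z.
Proof. by rewrite /enc; case: cid => f /= [_ finj]; apply: finj. Qed.

Lemma step_ex b a : exists c, a < b ->
  [/\ a <= c, c < b & forall c', a <= c' -> c' < b -> enc b c <= enc b c'].
Proof.
have [ab|] := boolP (a < b); last by exists a.
have [] := @wf_least _ _ wfT [set z | exists c, [/\ a <= c, c < b & enc b c = z]] (enc b a).
  by exists a.
move=> z [[c [ac cb cz]] zmin]; exists c => _; split=> // c' ac' c'b.
by rewrite cz; apply: zmin; exists c'.
Qed.

Definition step b a : T := projT1 (cid (step_ex b a)).

Lemma stepP b a : a < b -> [/\ a <= step b a, step b a < b &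
  forall c, a <= c -> c < b -> enc b (step b a) <= enc b c].
Proof. by rewrite /step; case: cid. Qed.

(* [stops m a b c]: the walk from [b] down to [a] visits [c], and [c] is its
   first point at which the next step has weight at least [m]. *)
Inductive stops m a : T -> T -> Prop :=
| stops_here b : a < b -> m <= enc b (step b a) -> stops m a b b
| stops_later b c : a < b -> enc b (step b a) < m ->
    stops m a (step b a) c -> stops m a b c.

Lemma stops_unique m a b c c' : stops m a b c -> stops m a b c' -> c = c'.
Proof.
move=> sc; elim: sc c' => {b c} [b ab mb|b c ab bm _ IH] c' sc'.
  inversion sc' as [|? ? _ bm _]; subst=> //.
  by move: mb; rewrite leNgt bm.
inversion sc' as [? _ mb|? ? _ _ sc'']; subst; last exact: IH.
by move: mb; rewrite leNgt bm.
Qed.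

Lemma stop_ex m a b : exists c, (exists c', stops m a b c') -> stops m a b c.
Proof. by have [[c ?]|n] := pselect (exists c, stops m a b c); [exists c|exists b]. Qed.

Definition stop m a b : T := projT1 (cid (stop_ex m a b)).

Lemma stopE m a b c : stops m a b c -> stop m a b = c.
Proof.
move=> sc; rewrite /stop; case: cid => c' /= sc'.
by apply: (stops_unique (sc' _) sc); exists c.
Qed.

Lemma dec_ex b z : exists c, forall c', c' < b -> enc b c' = z -> c = c'.
Proof.
have [[c cb cz]|n] := pselect (exists2 c, c < b & enc b c = z).
  by exists c => c' c'b c'z; apply: (enc_inj cb c'b); rewrite cz.
by exists b => c' c'b c'z; case: n; exists c'.
Qed.

Definition dec b z : T := projT1 (cid (dec_ex b z)).

Lemma encK b c : c < b -> dec b (enc b c) = c.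
Proof. by move=> cb; rewrite /dec; case: cid => c' /= /(_ c cb erefl). Qed.

(* The points of cardinality at most that of [mu]: the successor cardinal of
   [mu] when [mu] is an infinite initial ordinal. *)
Definition below_succ mu : set T := [set b | seg b #<= seg mu].

Lemma below_succ_down mu : down_closed (below_succ mu).
Proof.
by move=> x y; rewrite /below_succ /= => ymu xy; apply: card_le_trans ymu; apply/subset_card_le/seg_sub.
Qed.

Lemma below_succ_ge mu x : x <= mu -> below_succ mu x.
Proof. by move=> xmu; apply/subset_card_le/seg_sub. Qed.

Lemma below_succ_crd mu x : below_succ mu x -> crd x <= mu.
Proof. exact: crd_min. Qed.

Definition regular_pt mu := [/\ infinite_set (seg mu), initial_set (seg mu)
  & forall A, unbounded_in (seg mu) A -> seg mu #<= A `&` seg mu].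

(* For regular [mu], the limit points among these are those of cofinality [mu];
   successors qualify vacuously, as [unbounded_in] is strict. *)
Definition cofinality_ge mu : set T := [set c | below_succ mu c /\
  forall A, unbounded_in (seg c) A -> seg mu #<= A `&` seg c].

Hypothesis iniT : initial_set [set: T].

Section Successor.
Variable mu : T.
Hypothesis inf_mu : infinite_set (seg mu).
Local Notation L := (below_succ mu).

(** Were [L] no larger than [mu], the least point outside [L] would belong to [L]; if nothing lies
    outside, [iniT] applies. *)
Lemma below_succ_large : ~ (L #<= seg mu).
Proof.
move=> Lmu; have [[b nLb]|all] := pselect (exists b, ~ L b); last first.
  apply: (@iniT mu I); apply: card_le_trans Lmu; apply: subset_card_le => x _.
  by apply: contrapT => nLx; apply: all; exists x.
have [c [nLc cmin]] := @wf_least _ _ wfT (~` L) b nLb.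
apply: nLc; apply: card_le_trans Lmu; apply: subset_card_le => x /= xc.
by apply: contrapT => /cmin; rewrite leNgt xc.
Qed.

Lemma below_succ_initial : initial_set L.
Proof. by move=> x Lx Lle; apply: below_succ_large; apply: card_le_trans Lx. Qed.

Lemma below_succ_infinite : infinite_set L.
Proof.
apply: infinite_card_le inf_mu _; apply: subset_card_le => x /ltW; exact: below_succ_ge.
Qed.

Lemma below_succ_unbounded : unbounded_in L L.
Proof.
move=> x Lx; have [y Ly xy] := initial_no_max below_succ_initial below_succ_infinite Lx.
by exists y.
Qed.

(** Regularity of the successor cardinal: with [f y] in [A] above [y], sending [y] to [f y] and the
    weight of [y] below [f y] would inject [L] into the square of [mu]. *)
Lemma small_bounded A : A #<= seg mu -> ~ unbounded_in L A.
Proof.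
move=> Amu unb; apply: below_succ_large.
have /choice[f fP] : forall y, exists x, L y -> [/\ A x, L x & y < x].
  move=> y; have [Ly|nLy] := pselect (L y); last by exists y.
  by have [x ?] := unb y Ly; exists x.
apply: card_le_trans (seg_square wfT inf_mu); apply: card_le_trans (card_leX Amu (card_lexx _)).
apply: (@card_le_inj _ _ _ _ (fun y => (f y, enc (f y) y))).
  move=> y Ly; have [Af Lf yf] := fP y Ly; split=> //=.
  by apply: lt_le_trans (enc_lt yf) _; apply: below_succ_crd.
move=> y z Ly Lz [fyz]; have [_ _ yf] := fP y Ly; have [_ _ zf] := fP z Lz.
by rewrite -fyz in zf *; apply: enc_inj.
Qed.

Lemma small_strict_bound A : A #<= seg mu ->
  exists2 b, L b & forall x, A x -> L x -> x < b.
Proof.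
move=> /small_bounded/bounded_in[b Lb bA].
have [c [_ Lc bc]] := below_succ_unbounded Lb.
by exists c => // x Ax Lx; apply: le_lt_trans bc; apply: bA.
Qed.

End Successor.

Section Regular.
Variable mu : T.
Hypothesis reg_mu : regular_pt mu.
Local Notation L := (below_succ mu).
Local Notation S := (cofinality_ge mu).

Let inf_mu : infinite_set (seg mu). Proof. by case: reg_mu. Qed.
Let ini_mu : initial_set (seg mu). Proof. by case: reg_mu. Qed.

(* [mu] times in succession, step past points of all the [N x]. *)
Lemma common_limit (N : T -> set T) a : L a ->
    (forall x, x < mu -> unbounded_in L (N x)) ->
  exists c, [/\ S c, a < c & forall x, x < mu -> unbounded_in (seg c) (N x)].
Proof.
move=> La unbN.
have /choice[nxt nxtP] : forall b, exists b', L b ->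
    [/\ L b', b < b' & forall x, x < mu -> exists y, [/\ N x y, b < y & y < b']].
  move=> b; have [Lb|nLb] := pselect (L b); last by exists b.
  have /choice[n nP] : forall x, exists y, x < mu -> [/\ N x y, L y & b < y].
    move=> x; have [xmu|nx] := pselect (x < mu); last by exists x.
    by have [y ?] := unbN x xmu b Lb; exists y.
  have [|b1 Lb1 b1P] := @small_strict_bound _ inf_mu (n @` seg mu).
    exact: card_image_le.
  have [b2 [_ Lb2 bb2]] := below_succ_unbounded inf_mu Lb.
  exists (Order.max b1 b2) => _; split.
  - by case: (leP b1 b2).
  - by rewrite lt_max bb2 orbT.
  move=> x xmu; have [Nx Lnx bnx] := nP x xmu; exists (n x); split=> //.
  by rewrite lt_max b1P //; exists x.
(* A sequence of length [mu], each term above the [nxt] of all earlier ones; its supremum will be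
   [c]. The default [a] never occurs below [mu], by [fP]. *)
have [f fE] := @wf_rec _ _ wfT T (fun i rec =>
  if pselect (exists c, [/\ L c, a < c & forall j (ji : j < i), nxt (rec j ji) < c])
  is left ex then projT1 (cid ex) else a).
have fP i : i < mu -> [/\ L (f i), a < f i & forall j, j < i -> nxt (f j) < f i].
  elim/(wf_ind wfT): i => i IH imu; rewrite [f i]fE.
  case: pselect => [ex|[]]; first exact: projT2 (cid ex).
  have [|b1 Lb1 b1P] := @small_strict_bound _ inf_mu ((nxt \o f) @` seg i).
    by apply: card_le_trans (card_image_le _ _) _; apply/subset_card_le/seg_sub/ltW.
  have [b2 [_ Lb2 ab2]] := below_succ_unbounded inf_mu La.
  exists (Order.max b1 b2); split.
  - by case: (leP b1 b2).
  - by rewrite lt_max ab2 orbT.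
  move=> j ji; have jmu := lt_trans ji imu; rewrite lt_max b1P //; first by exists j.
  by have [Lfj _ _] := IH j ji jmu; have [] := nxtP _ Lfj.
have f_mono j i : j < i -> i < mu -> f j < f i.
  move=> ji imu; have [_ _ /(_ j ji)] := fP i imu; apply: lt_trans.
  by have [Lfj _ _] := fP j (lt_trans ji imu); have [] := nxtP _ Lfj.
have [|b Lb bP] := @small_strict_bound _ inf_mu (f @` seg mu); first exact: card_image_le.
have [|c [cP cmin]] := @wf_least _ _ wfT [set c | forall i, i < mu -> f i < c] b.
  by move=> i imu; apply: bP; [exists i|case: (fP i imu)].
have below_c y : y < c -> exists2 i, i < mu & y <= f i.
  move=> yc; apply: contrapT => nex; have : c <= y.
    by apply: cmin => i imu; rewrite ltNge; apply/negP => yfi; apply: nex; exists i.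
  by rewrite leNgt yc.
have [i0 i0mu] := infinite_setN0 inf_mu.
have Lc : L c.
  apply: (below_succ_down (y := b)) => //; apply: cmin => i imu.
  by apply: bP; [exists i|case: (fP i imu)].
exists c; split; first split=> //.
- move=> A unbA.
  (* [r y] is the least index whose term reaches [y]; it carries a set unbounded in [c] to one
     unbounded in [mu], which has size [mu] by regularity. *)
  have /choice[r rP] : forall y, exists i, y < c ->
      [/\ i < mu, y <= f i & forall j, j < mu -> y <= f j -> i <= j].
    move=> y; have [yc|ny] := pselect (y < c); last by exists y.
    have [i1 i1mu yi1] := below_c y yc.
    have [|i [[imu yi] imin]] := @wf_least _ _ wfT [set i | i < mu /\ y <= f i] i1.
      by [].
    by exists i => _; split=> // j jmu yj; apply: imin.
  have [_ _ /(_ (r @` (A `&` seg c)))] := reg_mu; move=> h.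
  apply: card_le_trans (card_image_le r _); apply: card_le_trans (h _) _.
    move=> i imu; have [i' i'mu ii'] := initial_no_max ini_mu inf_mu imu.
    have [y [Ay yc fiy]] := unbA (f i') (cP _ i'mu).
    have [rmu yfr rmin] := rP y yc.
    exists (r y); split=> //; first by exists y.
    apply: lt_le_trans ii' _; rewrite leNgt; apply/negP => ri'.
    have := lt_trans fiy (le_lt_trans yfr (f_mono _ _ ri' i'mu)).
    by rewrite ltxx.
  by apply: subset_card_le => ? [].
- by have [_ + _] := fP i0 i0mu; move/lt_trans; apply; apply: cP.
move=> x xmu y yc; have [i imu yi] := below_c y yc.
have [Lfi _ _] := fP i imu; have [_ _ /(_ x xmu)[z [Nz fiz znxt]]] := nxtP _ Lfi.
have [i' i'mu ii'] := initial_no_max ini_mu inf_mu imu.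
exists z; split=> //; last exact: le_lt_trans fiz.
apply: lt_trans znxt _; apply: lt_trans (cP _ i'mu).
by have [_ _ ->] := fP i' i'mu.
Qed.

Lemma enc_small b z X : z < mu -> (forall x, X x -> x < b /\ enc b x <= z) ->
  ~ (seg mu #<= X).
Proof.
move=> zmu Xz muX; have [z' z'mu zz'] := initial_no_max ini_mu inf_mu zmu.
apply: (ini_mu z'mu); apply: card_le_trans muX _.
apply: (@card_le_inj _ _ _ _ (enc b)) => [x /Xz[_ xz]|x y /Xz[xb _] /Xz[yb _]].
  exact: le_lt_trans zz'.
exact: enc_inj.
Qed.

(** [enc b] is injective, so fewer than [mu] points have weight at most [z], too few to be unbounded
    in a point of cofinality [mu]. *)
Lemma enc_small_bounded c b z : S c -> z < mu -> c <= b ->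
  exists2 y, y < c & forall x, y < x -> x < c -> z < enc b x.
Proof.
move=> [Lc cofc] zmu cb; pose X := [set x | x < b /\ enc b x <= z].
have /bounded_in[y yc yP] : ~ unbounded_in (seg c) X.
  move=> /cofc; apply: (@enc_small b z) => // x [[xb xz] _].
  by [].
exists y => // x yx xc; rewrite ltNge; apply/negP => xz.
have := yP x; rewrite leNgt yx => h; suff: false by [].
by apply: h => //; split=> //; apply: lt_le_trans cb.
Qed.

(** Induction along the walk from [b] to [c]. Close below [c] every point is heavier than the step
    made towards [c], so the walks to [a] and to [c] share that step; [m] exceeds the weights of the
    steps made before [c]. *)
Lemma walk_stops c b : S c -> L b -> c <= b -> (exists y, y < c) ->
  exists y m, [/\ y < c, m < mu & forall a n, y < a -> a < c -> m <= n ->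
    n <= enc c (step c a) -> stops n a b c].
Proof.
move=> Sc Lb + [y0 y0c]; elim/(wf_ind wfT): b Lb => b IH Lb cb.
have Lc : L c by case: Sc.
move: cb; rewrite le_eqVlt => /orP[/eqP <-|cb].
  exists y0, (enc c y0); split=> //.
    by apply: lt_le_trans (enc_lt y0c) _; apply: below_succ_crd.
  by move=> a n _ ac _ nle; apply: stops_here.
have [cs sb smin] := stepP cb; set s := step b c in cs sb smin.
have Ls : L s by apply: (below_succ_down Lb); apply: ltW.
have smu : enc b s < mu by apply: lt_le_trans (enc_lt sb) _; apply: below_succ_crd.
have [y1 [m1 [y1c m1mu IHs]]] := IH s sb Ls cs.
have [y2 y2c y2P] := enc_small_bounded Sc smu (ltW cb).
have [m2 m2mu sm2] := initial_no_max ini_mu inf_mu smu.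
exists (Order.max y1 y2), (Order.max m1 m2); split.
- by rewrite gt_max y1c.
- by rewrite gt_max m1mu.
move=> a n; rewrite gt_max ge_max => /andP[y1a y2a] ac /andP[m1n m2n] nle.
have ab := lt_trans ac cb.
have Es : step b a = s.
  have [as' s'b s'min] := stepP ab.
  have s's : enc b (step b a) <= enc b s by apply: s'min => //; apply: le_trans cs; apply: ltW.
  have cs' : c <= step b a.
    rewrite leNgt; apply/negP => s'c; have := y2P _ (lt_le_trans y2a as') s'c.
    by rewrite ltNge s's.
  by apply: (enc_inj s'b sb); apply/eqP; rewrite eq_le s's smin.
apply: stops_later => //; rewrite Es; first exact: lt_le_trans sm2 m2n.
exact: IHs.
Qed.

Lemma step_heavy c m : S c -> m < mu -> exists2 y, y < c &
  forall a, y < a -> a < c -> m <= enc c (step c a).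
Proof.
move=> Sc mmu; have [y yc yP] := enc_small_bounded Sc mmu (lexx c).
exists y => // a ya ac; have [as' sc _] := stepP ac.
by apply/ltW/yP => //; apply: lt_le_trans as'.
Qed.

(** Below a limit [c] of [N] of cofinality [mu] lie [mu] points of [N], too many to have weight
    below [m] under one [b]. So thresholds for [stop] can be named by elements of [N]. *)
Lemma heavy_pair N m : unbounded_in L N -> m < mu ->
  exists a b, [/\ N a, N b, a < b, m <= enc b a & enc b a < mu].
Proof.
move=> unbN mmu; have Lmu : L mu by apply: below_succ_ge.
have [c [[Lc cofc] _ /(_ m mmu) Nc]] := common_limit Lmu (fun x _ => unbN).
have [b [Nb Lb cb]] := unbN c Lc.
have [a [Na ac ma]] : exists a, [/\ N a, a < c & m <= enc b a].
  apply: contrapT => nex; apply: (@enc_small b m (N `&` seg c)) => //; last exact: cofc.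
  move=> x [Nx xc]; split; first exact: lt_trans cb.
  by rewrite leNgt; apply/negP => mx; apply: nex; exists x; rewrite ltW.
have ab := lt_trans ac cb.
exists a, b; split=> //; apply: lt_le_trans (enc_lt ab) _; exact: below_succ_crd.
Qed.

(* Ulam: for every [a] some value [enc c a = z] recurs stationarily often, and
   by pigeonhole one [z] serves [mu] many [a]; then [c] determines [a]. *)
Lemma guessing : exists g : T -> T, forall z N, z < mu -> unbounded_in L N ->
  exists c, [/\ S c, exists y, y < c, unbounded_in (seg c) N & g c = z].
Proof.
pose good a z := forall N, unbounded_in L N ->
  exists c, [/\ S c, a < c, unbounded_in (seg c) N & enc c a = z].
have exgood a : L a -> exists2 z, z < mu & good a z.
  move=> La; apply: contrapT => nex.
  (* Diagonalisation: take a counterexample [N z] for each colour [z]; at a common limit [c] of them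
     all, the colour [enc c a] defeats its own counterexample. *)
  have /choice[N NP] : forall z, exists N, z < mu -> unbounded_in L N /\
      ~ exists c, [/\ S c, a < c, unbounded_in (seg c) N & enc c a = z].
    move=> z; apply: contrapT => nN; have [zmu|nz] := pselect (z < mu); last first.
      by apply: nN; exists set0.
    apply: nex; exists z => // N unbN; apply: contrapT => nc.
    by apply: nN; exists N.
  have [c [Sc ac cN]] := common_limit La (fun z zmu => (NP z zmu).1).
  have Lc : L c by case: Sc.
  have zmu : enc c a < mu.
    by apply: lt_le_trans (enc_lt ac) _; apply: below_succ_crd.
  by apply: (NP _ zmu).2; exists c; split=> //; apply: cN.
have [z zmu [j jP]] : exists2 z, z < mu & exists j : T -> T,
    (forall x, x < mu -> good (j x) z) /\
    (forall x y, x < mu -> y < mu -> j x = j y -> x = y).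
  apply: contrapT => nex; apply: (@below_succ_large mu).
  apply: card_le_trans (seg_square wfT inf_mu).
  have small z : z < mu -> [set a | L a /\ good a z] #<= seg mu.
    move=> zmu; have [mule|[y ymu le]] :=
      @card_le_or_seg _ _ wfT _ [set a | L a /\ good a z] (seg mu).
      case: nex; exists z => //.
      by have /(inj_card_leP z)[j [jg jinj]] := mule; exists j; split=> [x /jg[]|].
    by apply: card_le_trans le _; apply: subset_card_le => x [].
  have /choice[h hP] : forall z, exists f : T -> T, z < mu ->
      (forall a, L a -> good a z -> f a < mu) /\
      (forall a b, L a -> good a z -> L b -> good b z -> f a = f b -> a = b).
    move=> z; have [zmu|nz] := pselect (z < mu); last by exists id.
    have /(inj_card_leP z)[f [fmu finj]] := small z zmu; exists f => _.
    by split=> [a La ga|a b La ga Lb gb]; [apply: fmu|apply: finj].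
  have /choice[k kP] : forall a, exists z, L a -> z < mu /\ good a z.
    move=> a; have [La|nLa] := pselect (L a); last by exists a.
    by have [z] := exgood a La; exists z.
  apply: (@card_le_inj _ _ _ _ (fun a => (k a, h (k a) a))).
    by move=> a La; have [ka ga] := kP a La; split=> //=; apply: (hP _ ka).1.
  move=> a b La Lb [kab]; have [ka ga] := kP a La; have [kb gb] := kP b Lb.
  by rewrite -kab in gb *; apply: (hP _ ka).2.
have /choice[g gP] : forall c, exists x, forall x', x' < mu -> j x' < c ->
    enc c (j x') = z -> x = x'.
  move=> c; have [[x [xmu jxc ex]]|n] :=
      pselect (exists x, [/\ x < mu, j x < c & enc c (j x) = z]).
    exists x => x' x'mu jx'c ex'; apply: jP.2 => //.
    by apply: (enc_inj jxc jx'c); rewrite ex.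
  by exists c => x xmu jxc ex; case: n; exists x.
exists g => x N xmu unbN; have [c [Sc jc cN cz]] := jP.1 x xmu N unbN.
by exists c; split=> //; [exists (j x)|apply: gP].
Qed.

(** Guessing provides a limit [c] of [N] with colour [z], and a walk between points of [N] on either
    side of [c] stops at [c]. *)
Lemma walk_colours : exists g : T -> T, forall z N, z < mu -> unbounded_in L N ->
  exists a' b' a b, [/\ N a', N b', N a, N b & g (stop (enc b' a') a b) = z].
Proof.
have [g gP] := guessing; exists g => z N zmu unbN.
have [c [Sc c0 cN gc]] := gP z N zmu unbN; have Lc : L c by case: Sc.
have [b [Nb Lb cb]] := unbN c Lc.
have [y1 [m [y1c mmu walk]]] := walk_stops Sc Lb (ltW cb) c0.
have [a' [b' [Na' Nb' ab' mab abmu]]] := heavy_pair unbN mmu.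
have [y2 y2c heavy] := step_heavy Sc abmu.
have [a [Na ac]] := cN (Order.max y1 y2) (ltac:(by rewrite /seg /= gt_max y1c)).
rewrite gt_max => /andP[y1a y2a].
exists a', b', a, b; split=> //; rewrite (stopE (walk a _ y1a ac mab _)) //.
exact: heavy.
Qed.

End Regular.
End Walks.

(** * An operation closing up increasing chains *)

Definition points (k : cardinal) : Type := k.

HB.instance Definition _ (k : cardinal) := Choice.copy (points k) (cardinal_sort k).

Section CardinalOrder.
Variable k : cardinal.
Local Notation le := (@cardinal_le k : rel (points k)).

Lemma cardinal_le_refl : reflexive le.
Proof. by move=> x; apply: (@wo_chain_reflexive _ le predT) => // A _; apply: cardinal_wo. Qed.

Lemma cardinal_le_anti : antisymmetric le.
Proof. by move=> x y; apply: (@wo_chain_antisymmetric _ le predT) => // A _; apply: cardinal_wo. Qed.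

Lemma cardinal_le_total : total le.
Proof. by move=> x y; apply: (@wo_chainW _ le predT) => // A _; apply: cardinal_wo. Qed.

Lemma cardinal_least (P : set (points k)) x : P x ->
  exists2 y, P y & forall z, P z -> le y z.
Proof.
move=> Px; have [|y [[Py ymin] _]] := @cardinal_wo k (fun z => `[< P z >]).
  by exists x; apply/asboolP.
by exists y => [|z Pz]; [exact/asboolP|apply: ymin; apply/asboolP].
Qed.

Lemma cardinal_le_trans : transitive le.
Proof.
move=> y x z xy yz.
have [|w [->|[->|->]] wmin] := @cardinal_least [set w | w = x \/ w = y \/ w = z] x.
- by left.
- by apply: wmin; right; right.
- by have -> : x = y by apply: cardinal_le_anti; rewrite xy wmin //; left.
- have -> : z = y by apply: cardinal_le_anti; rewrite yz wmin //; right; left.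
  by [].
Qed.

HB.instance Definition _ := Order.Le_isPOrder.Build (Order.Disp tt tt) (points k)
  cardinal_le_refl cardinal_le_anti cardinal_le_trans.
HB.instance Definition _ := Order.POrder_isTotal.Build _ (points k) cardinal_le_total.

Lemma points_wf : well_founded (fun x y : points k => x < y).
Proof.
move=> x; apply: contrapT => nx.
have [y ny ymin] := @cardinal_least (fun y => ~ Acc (fun x y : points k => x < y) y) x nx.
apply: ny; constructor=> z zy; apply: contrapT => /ymin.
by have := zy; rewrite ltNge => /negP.
Qed.

Lemma points_initial : initial_set [set: points k].
Proof.
move=> x _ /card_le_trans le; have /negP := @cardinal_initial k x; apply; apply: le.
by apply: subset_card_le => y; rewrite /seg /= lt_neqAle => /andP[/eqP yx yle].
Qed.

End CardinalOrder.

(** The bounds [b i] form a cofinal set of size at most [sigma]. Conversely, the indices at which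
    the chain captures the elements of a cofinal set are cofinal in [sigma]. *)
Lemma cofinal_chain (sigma lambda : cardinal) (D : sigma -> set (points lambda)) :
    regular sigma -> infinite_set [set: lambda] ->
    (forall i j, cardinal_le i j -> D i `<=` D j) ->
    (forall x, exists i, D i x) ->
    (forall i, exists b, forall x, D i x -> x <= b) ->
  is_cf sigma lambda.
Proof.
move=> [_ [_ reg_sigma]] inf mono cover /choice[b bP].
have large (A : set (points lambda)) : cofinal A -> [set: sigma] #<= A.
  move=> cofA; have /choice[r rP] := cover.
  apply: card_le_trans (reg_sigma (r @` A) _) (card_image_le _ _) => i.
  have [y _ biy] := initial_no_max (@points_initial lambda) inf (I : [set: points lambda] (b i)).
  have [a Aa ya] := cofA y; exists (r a); first by exists a.
  have := cardinal_le_total (i : points sigma) (r a); case/orP=> // /mono/(_ _ (rP a))/bP.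
  by rewrite leNgt => /negP[]; apply: lt_le_trans ya.
split=> //; exists (range b); last first.
  by rewrite card_eq_le card_image_le large // => x; have [i /bP] := cover x; exists (b i) => //; exists i.
by move=> x; have [i /bP] := cover x; exists (b i) => //; exists i.
Qed.

Lemma cofinality_unique (sigma tau kappa : cardinal) :
  is_cf sigma kappa -> is_cf tau kappa -> [set: sigma] #= [set: tau].
Proof.
move=> [[A cA eA] sm] [[B cB eB] tm]; rewrite card_eq_le; apply/andP; split.
  by apply: card_le_trans (sm B cB) _; case/card_eqPle: eB.
by apply: card_le_trans (tm A cA) _; case/card_eqPle: eA.
Qed.

(** * Initial segments as cardinals *)

Section SegCardinal.
Variables (lambda : cardinal) (nu : points lambda).
Hypothesis ini_nu : initial_set (seg nu).

Let seg_type := {x : points lambda | x < nu}.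
Let seg_le : rel seg_type := fun x y => val x <= val y.

Let seg_wo : well_order seg_le.
Proof.
apply: antisymmetric_well_order => [x y /le_anti/val_inj //|A [x Ax]].
have [|z [zA zmin]] := @wf_least _ _ (@points_wf lambda) [set z | exists2 y, y \in A & val y = z] (val x).
  by exists x.
case: zA zmin => y Ay <- zmin; exists y; split=> // w Aw.
by apply: zmin; exists w.
Qed.

Let val_card (A : set seg_type) : A #= (val @` A : set (points lambda)).
Proof. by apply: card_esym; apply: inj_card_eq => x y _ _ /val_inj. Qed.

Let val_setT : val @` [set: seg_type] = seg nu :> set (points lambda).
Proof.
apply/seteqP; split=> [_ [[x xnu] _ <-] //|x xnu].
by exists (exist _ x xnu).
Qed.

Let seg_initial x : ~~ ([set: seg_type] #<= [set y | seg_le y x /\ y <> x]).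
Proof.
apply/negP => le; apply: (ini_nu (valP x)).
rewrite -val_setT; apply: card_le_trans (_ : [set: seg_type] #<= _).
  by case/card_eqPle: (val_card [set: seg_type]).
apply: card_le_trans le _; case/card_eqPle: (val_card [set y | seg_le y x /\ y <> x]) => + _.
move/card_le_trans; apply; apply: subset_card_le => _ [y [yx nyx] <-].
by rewrite /seg /= lt_neqAle; apply/andP; split=> //; apply/eqP => /val_inj.
Qed.

Definition seg_cardinal : cardinal := Cardinal seg_wo seg_initial.

Lemma seg_cardinalE : [set: seg_cardinal] #= seg nu.
Proof. by rewrite -val_setT; apply: val_card. Qed.

Lemma seg_cardinal_cf (sigma : cardinal) (D : sigma -> set (points lambda)) :
    regular sigma -> infinite_set (seg nu) ->
    (forall i j, cardinal_le i j -> D i `<=` D j) ->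
    (forall x, x < nu -> exists i, D i x) ->
    (forall i, exists2 b, b < nu & forall x, D i x -> x < nu -> x <= b) ->
  is_cf sigma seg_cardinal.
Proof.
move=> rs inf mono cover bounded.
apply: (@cofinal_chain sigma seg_cardinal (fun i => [set x | D i (val x)])) => //.
- by apply: infinite_card_le inf _; case/card_eqPle: seg_cardinalE.
- by move=> i j ij x; apply: mono.
- by move=> [x xnu]; apply: cover.
move=> i; have [b bnu bP] := bounded i; exists (exist _ b bnu) => -[x xnu] /= Dx.
exact: bP.
Qed.

End SegCardinal.

Section SuccessorRegular.
Context {d : Order.disp_t} {T : orderType d}.
Hypothesis wfT : well_founded (fun x y : T => x < y).
Hypothesis iniT : initial_set [set: T].

(** [mu] is the least point outside [below_succ nu], so its segment is the successor cardinal;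
    regularity is [small_bounded]. *)
Lemma successor_regular (nu : T) : infinite_set (seg nu) ->
    (exists x, ~ below_succ nu x) ->
  exists2 mu, regular_pt mu & forall x, below_succ nu x <-> x < mu.
Proof.
move=> inf_nu [x0 nx0].
have [mu [nmu mumin]] := @wf_least _ _ wfT (~` below_succ nu) x0 nx0.
have muP x : below_succ nu x <-> x < mu.
  split=> [nux|xmu].
    rewrite ltNge; apply/negP => mux; apply: nmu; apply: below_succ_down mux; exact: nux.
  by apply: contrapT => /mumin; rewrite leNgt xmu.
have muE : seg mu = below_succ nu by apply/seteqP; split=> x /muP.
exists mu => //; split; rewrite ?muE.
- exact: below_succ_infinite.
- exact: below_succ_initial.
move=> A unbA; have [//|[y nuy le]] := @card_le_or_seg _ _ wfT _ (A `&` below_succ nu) (below_succ nu).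
exfalso; apply: (@small_bounded _ _ wfT iniT nu inf_nu (A `&` below_succ nu)).
  by apply: card_le_trans le _; apply: card_le_trans nuy; apply: subset_card_le => x [].
by move=> x /unbA[z [Az nuz xz]]; exists z.
Qed.

(** When the whole order is a successor cardinal, this finds its cardinal predecessor. *)
Lemma below_succ_least (nu : T) : (forall x, below_succ nu x) ->
  exists2 nu' : T, (forall x, below_succ nu' x) & initial_set (seg nu').
Proof.
move=> all_nu.
have [nu' [all' min']] := @wf_least _ _ wfT [set nu | forall x, below_succ nu x] nu all_nu.
exists nu' => // y ynu le; have : nu' <= y.
  by apply: min' => x; apply: card_le_trans le; apply: all'.
by rewrite leNgt ynu.
Qed.

End SuccessorRegular.

(** The injection [h] of [sigma] into [nu] may fail to be monotone, but the indices mapped below a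
    given [x] are bounded by some [b x], and [b] takes unbounded sets to cofinal ones. *)
Lemma regular_transfer (sigma lambda : cardinal) (nu : points lambda) :
    regular sigma -> initial_set (seg nu) ->
    [set: sigma] #<= seg nu -> seg nu #<= [set: sigma] ->
  regular_pt nu.
Proof.
move=> [inf_sigma [_ reg_sigma]] ini_nu sle les.
have inf_nu : infinite_set (seg nu) by apply: infinite_card_le sle.
split=> // A unbA.
have [i0 _] := infinite_setN0 inf_sigma.
have /(inj_card_leP (nu : points lambda))[h [hnu hinj]] := sle.
have /choice[b bP] : forall x : points lambda, exists b : points sigma,
    x < nu -> forall i : points sigma, h i < x -> i <= b.
  move=> x; have [xnu|nx] := pselect (x < nu); last by exists i0.
  apply: contrapT => nb; apply: (ini_nu _ xnu); apply: card_le_trans les _.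
  apply: card_le_trans (reg_sigma [set i | h i < x] _) _.
    move=> i; apply: contrapT => ni; apply: nb; exists i => _ j hj.
    by apply: contrapT => /negP; rewrite -ltNge => /ltW ij; apply: ni; exists j.
  by apply: (@card_le_inj _ _ _ _ h) => [i //|i j _ _]; apply: hinj.
apply: card_le_trans les _.
apply: card_le_trans (reg_sigma (b @` (A `&` seg nu)) _) (card_image_le _ _) => i.
have [x [Ax xnu hx]] := unbA (h i) (hnu i I).
exists (b x); first by exists x.
exact: (bP x xnu i hx).
Qed.

Section Operation.
Variable lambda : cardinal.
Hypothesis inf_lambda : infinite_set [set: lambda].
Local Notation T := (points lambda).

Let wfT := @points_wf lambda.
Let iniT := @points_initial lambda.
Local Notation enc := (enc wfT).
Local Notation crd := (crd wfT).
Local Notation stop := (stop wfT).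
Local Notation dec := (dec wfT).

Variable g : T -> T -> T.
Hypothesis gP : forall mu, regular_pt mu -> forall z N, z < mu ->
  unbounded_in (below_succ mu) N ->
  exists a' b' a b, [/\ N a', N b', N a, N b & g mu (stop (enc b' a') a b) = z].

(** Entry 1 is the regular [mu], entries 2 and 3 name the threshold, 4 and 5 are the ends of the
    walk; the resulting colour is decoded as a predecessor of entry 0. *)
Definition walk_op (s : 'I_6 -> T) : T :=
  let s i := s (inord i) in
  dec (s 0%N) (g (s 1%N) (stop (enc (s 3%N) (s 2%N)) (s 4%N) (s 5%N))).

Variable sigma : cardinal.
Hypothesis reg_sigma : regular sigma.
Hypothesis sigma_lt : card_lt sigma lambda.
Hypothesis sigma_cf : ~ is_cf sigma lambda.
Hypothesis sigma_cf_pred :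
  ~ exists mu : cardinal, [/\ is_succ_card lambda mu, singular mu & is_cf sigma mu].

Variable u : points sigma -> set T.
Hypothesis u_mono : forall i j, i <= j -> u i `<=` u j.
Hypothesis u_cover : forall x, exists i, u i x.

Definition reached i z := exists mu a' b' a b,
  [/\ [/\ u i mu, u i a' & u i b'], u i a, u i b & g mu (stop (enc b' a') a b) = z].

Lemma reached_mono i j : i <= j -> reached i `<=` reached j.
Proof.
move=> ij z [mu [a' [b' [a [b [[? ? ?] ? ? gz]]]]]]; exists mu, a', b', a, b.
by do ?split=> //; apply: u_mono ij _ _.
Qed.

Let inf_sigma : infinite_set [set: sigma]. Proof. by case: reg_sigma. Qed.

Lemma sigma_seg : exists s : T, [set: sigma] #<= seg s.
Proof.
have [le|[s _ le]] := @card_le_or_seg _ _ wfT _ [set: sigma] [set: T].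
  by case: sigma_lt => _; rewrite le.
by exists s; apply: card_le_trans le _; apply: subset_card_le => x [].
Qed.

(** Were every [u i] bounded in the successor of [mu], these at most [mu] bounds would have a common
    bound. An unbounded [u i] reaches all colours by [gP]. *)
Lemma reached_regular mu : regular_pt mu -> [set: sigma] #<= seg mu ->
  exists i, forall z, z < mu -> reached i z.
Proof.
move=> reg_mu sle; have inf_mu : infinite_set (seg mu) by case: reg_mu.
have [i unb] : exists i, unbounded_in (below_succ mu) (u i).
  apply: contrapT => nunb.
  have /choice[b bP] : forall i, exists b, below_succ mu b /\
      forall x, u i x -> below_succ mu x -> x <= b.
    move=> i; have /bounded_in[b Lb bP] : ~ unbounded_in (below_succ mu) (u i).
      by move=> ub; apply: nunb; exists i.
    by exists b.
  have [|c Lc cP] := @small_strict_bound _ _ wfT iniT mu inf_mu (range b).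
    by apply: card_le_trans (card_image_le _ _) sle.
  have [i uic] := u_cover c.
  have := (bP i).2 c uic Lc; rewrite leNgt => /negP; apply.
  by apply: cP; [exists i|case: (bP i)].
have [j ujmu] := u_cover mu.
exists (Order.max i j) => z zmu.
have [a' [b' [a [b [ua' ub' ua ub gz]]]]] := gP reg_mu zmu unb.
have ij : u i `<=` u (Order.max i j) by apply: u_mono; rewrite le_max lexx.
exists mu, a', b', a, b; split; do ?[split]; do ?exact: ij; last by [].
by apply: u_mono ujmu; rewrite le_max lexx orbT.
Qed.

(** As [sigma] is not the cofinality of [lambda], some [u j] is unbounded; each [x] is decoded from
    its weight below some [b] in [u j], and that weight is a reached colour. *)
Lemma reached_onto i : (forall b z, z < crd b -> reached i z) ->
  exists j, forall x, exists2 s, (forall k, u j (s k)) & walk_op s = x.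
Proof.
move=> all_i.
have [j unb] : exists j, forall x, exists2 y, u j y & x < y.
  apply: contrapT => nunb; apply: sigma_cf; apply: (cofinal_chain (D := u)) => // j.
  apply: contrapT => nb; apply: nunb; exists j => x; apply: contrapT => ny.
  apply: nb; exists x => y uy; rewrite leNgt; apply/negP => xy.
  by apply: ny; exists y.
exists (Order.max i j) => x.
have [b ub xb] := unb x; have := all_i b _ (enc_lt wfT xb).
move=> [mu [a' [b' [a [c [[umu ua' ub'] ua uc gz]]]]]].
have iu : u i `<=` u (Order.max i j) by apply: u_mono; rewrite le_max lexx.
have ju : u j `<=` u (Order.max i j) by apply: u_mono; rewrite le_max lexx orbT.
exists (fun k => nth b [:: b; mu; a'; b'; a; c] k).
  by move=> [[|[|[|[|[|[|k]]]]]] kP] //=; first [exact: iu|exact: ju].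
by rewrite /walk_op !inordK //= gz encK.
Qed.

(* All colours below a regular point are reached at once, so reaching can only
   stall at a point of cofinality [sigma]; cardinal successors being regular,
   that leaves [lambda] itself and its cardinal predecessor. *)
Lemma walk_op_onto :
  exists j, forall x, exists2 s, (forall k, u j (s k)) & walk_op s = x.
Proof.
have [s0 sle0] := sigma_seg.
have reach_succ nu : infinite_set (seg nu) -> [set: sigma] #<= seg nu ->
    (exists x, ~ below_succ nu x) -> exists i, forall z, z < nu -> reached i z.
  move=> inf_nu sle nall.
  have [mu reg_mu muP] := successor_regular wfT iniT inf_nu nall.
  have nu_mu : nu < mu by apply/muP; apply: below_succ_ge.
  have [|i iP] := reached_regular reg_mu.
    by apply: card_le_trans sle _; apply/subset_card_le/seg_sub/ltW.
  by exists i => z znu; apply: iP; apply: lt_trans nu_mu.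
(* Successor or limit cardinal. In the limit case every [y] has a regular cardinal above it, so all
   colours below [y] are reached at some stage. *)
have [[nu0 all0]|lim] := pselect (exists nu : T, forall x, below_succ nu x); last first.
  have reach y : exists i, forall z, z < y -> reached i z.
    pose y' := Order.max y s0.
    have sle : [set: sigma] #<= seg y'.
      by apply: card_le_trans sle0 _; apply/subset_card_le/seg_sub; rewrite le_max lexx orbT.
    have [|i iP] := reach_succ y' (infinite_card_le inf_sigma sle) sle.
      apply: contrapT => nx; apply: lim; exists y' => x.
      by apply: contrapT => nx'; apply: nx; exists x.
    by exists i => z zy; apply: iP; rewrite lt_max zy.
  have [i iP] : exists i, forall x, exists2 y, (forall z, z < y -> reached i z) & x < y.
    apply: contrapT => nunb; apply: sigma_cf.
    apply: (@cofinal_chain sigma lambda (fun i => [set y | forall z, z < y -> reached i z])) => //.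
      by move=> i j ij y yP z /yP; apply: reached_mono.
    move=> i; apply: contrapT => nb; apply: nunb; exists i => x; apply: contrapT => ny.
    by apply: nb; exists x => y yP; rewrite leNgt; apply/negP => xy; apply: ny; exists y.
  by apply: (@reached_onto i) => b z _; have [y yP zy] := iP z; apply: yP.
have [nu all_nu ini_nu] := below_succ_least wfT all0.
have crd_nu b : crd b <= nu by apply: crd_min; apply: all_nu.
suff [i iP] : exists i, forall z, z < nu -> reached i z.
  by apply: (@reached_onto i) => b z zb; apply: iP; apply: lt_le_trans zb (crd_nu b).
have sle : [set: sigma] #<= seg nu by apply: card_le_trans sle0 (all_nu s0).
have inf_nu := infinite_card_le inf_sigma sle.
(* Here [lambda] is the successor of [nu]. If [nu] is not regular, the argument of the limit case is
   repeated below [nu]; it fails only if [sigma] is the cofinality of [nu]. *)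
have [reg_nu|nreg] := pselect (regular_pt nu); first exact: reached_regular.
have nle : ~ (seg nu #<= [set: sigma]).
  by move=> le; apply: nreg; apply: regular_transfer le.
have [//|[y0 y0nu sley0]] := @card_le_or_seg _ _ wfT _ [set: sigma] (seg nu).
have reach y : y < nu -> exists i, forall z, z < y -> reached i z.
  move=> ynu; pose y' := Order.max y y0.
  have y'nu : y' < nu by rewrite gt_max ynu.
  have sle' : [set: sigma] #<= seg y'.
    apply: card_le_trans sley0 _; apply: card_le_trans (subset_card_le (@subIsetr _ _ _)) _.
    by apply/subset_card_le/seg_sub; rewrite le_max lexx orbT.
  have [|i iP] := reach_succ y' (infinite_card_le inf_sigma sle') sle'.
    by exists nu => le; apply: (ini_nu _ y'nu).
  by exists i => z zy; apply: iP; rewrite lt_max zy.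
apply: contrapT => nreached; apply: sigma_cf_pred.
have cf_nu : is_cf sigma (seg_cardinal ini_nu).
  apply: (@seg_cardinal_cf _ _ ini_nu sigma (fun i => [set y | forall z, z < y -> reached i z])) => //.
    by move=> i j ij y yP z /yP; apply: reached_mono.
  move=> i; apply: contrapT => nb; apply: nreached; exists i => x xnu.
  apply: contrapT => nx; apply: nb; exists x => // y yP ynu.
  by rewrite leNgt; apply/negP => xy; apply: nx; apply: yP.
have /card_eqPle[nuE nuE'] := seg_cardinalE ini_nu.
exists (seg_cardinal ini_nu); split=> //.
  split; first split.
  - by apply: card_le_trans nuE (card_leT _).
  - by apply/negP => le; apply: (@iniT nu I); apply: card_le_trans le nuE.
  move=> kappa [_ /negP nk].
  have [//|[y _ le]] := @card_le_or_seg _ _ wfT _ [set: kappa] [set: T].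
  case: nk; apply: card_le_trans nuE'; apply: card_le_trans (all_nu y).
  by apply: card_le_trans le _; apply: subset_card_le => x [].
exists sigma => //; split; first exact: card_le_trans sle nuE'.
by apply/negP => le; apply: nle; apply: card_le_trans nuE' le.
Qed.

End Operation.

Definition walk_colouring lambda (g : points lambda -> points lambda -> points lambda) :=
  forall mu, regular_pt mu -> forall z N, z < mu -> unbounded_in (below_succ mu) N ->
  exists a' b' a b, [/\ N a', N b', N a, N b &
    g mu (stop (@points_wf lambda) (enc (@points_wf lambda) b' a') a b) = z].

Lemma walk_colouring_ex lambda : exists g, @walk_colouring lambda g.
Proof.
have /choice[g gP] : forall mu : points lambda, exists f : points lambda -> points lambda,
    regular_pt mu -> forall z N, z < mu -> unbounded_in (below_succ mu) N ->
    exists a' b' a b, [/\ N a', N b', N a, N b &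
      f (stop (@points_wf lambda) (enc (@points_wf lambda) b' a') a b) = z].
  move=> mu; have [reg_mu|nreg] := pselect (regular_pt mu); last by exists id.
  by have [f fP] := walk_colours (@points_wf lambda) (@points_initial lambda) reg_mu; exists f.
by exists g => mu; apply: gP.
Qed.

(** [O] is chosen before [sigma], so that one group can serve all [sigma] at once. *)
Theorem indecomposable_operation (lambda : cardinal) : infinite_set [set: lambda] ->
  exists O : ('I_6 -> lambda) -> lambda, forall sigma : cardinal,
    card_lt sigma lambda -> regular sigma -> ~ is_cf sigma lambda ->
    ~ (exists mu : cardinal, [/\ is_succ_card lambda mu, singular mu & is_cf sigma mu]) ->
    forall u : sigma -> set lambda,
      (forall i j, cardinal_le i j -> u i `<=` u j) -> (forall x, exists i, u i x) ->
    exists i, forall x, exists2 s, (forall k, u i (s k)) & O s = x.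
Proof.
move=> inf; have [g gP] := walk_colouring_ex lambda.
exists (walk_op g) => sigma lt reg ncf npred u mono cover.
exact: (walk_op_onto inf gP reg lt ncf npred mono cover).
Qed.

(** * Groups generated by involutions *)

Section WordGroup.
Variables (X gen : Type) (act : gen -> X -> X).

Definition word_act (w : seq gen) (x : X) : X := foldr act x w.

Lemma word_act_cat w1 w2 x : word_act (w1 ++ w2) x = word_act w1 (word_act w2 x).
Proof. by rewrite /word_act foldr_cat. Qed.

Hypothesis actK : forall g, involutive (act g).

Lemma word_act_rev w : cancel (word_act w) (word_act (rev w)).
Proof.
move=> x; elim: w => //= g w IH.
by rewrite rev_cons -cats1 word_act_cat /= actK.
Qed.

Lemma word_act_revK w : cancel (word_act (rev w)) (word_act w).
Proof. by move=> x; rewrite -{1}[w]revK word_act_rev. Qed.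

(** The word is only asserted to exist, so elements are equal once they agree as permutations. *)
Record word_map := WordMap {
  word_fun :> X -> X;
  word_funP : exists w, word_fun = word_act w }.

Lemma word_map_inj : injective word_fun.
Proof. by move=> [f fP] [f' f'P] /= ff'; subst f'; congr WordMap; apply: Prop_irrelevance. Qed.

HB.instance Definition _ := gen_eqMixin word_map.
HB.instance Definition _ := gen_choiceMixin word_map.

Definition word_of (w : seq gen) : word_map := WordMap (ex_intro _ w erefl).

Lemma word_ofP (f : word_map) : exists w, f = word_of w.
Proof. by have [w fw] := word_funP f; exists w; apply: word_map_inj. Qed.

Lemma word_one_subproof : exists w, id = word_act w.
Proof. by exists [::]. Qed.

Definition word_one := WordMap word_one_subproof.

Lemma word_mul_subproof (f g : word_map) : exists w, f \o g = word_act w.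
Proof.
have [[w ->] [w' ->]] := (word_funP f, word_funP g); exists (w ++ w').
by apply/funext => x; rewrite word_act_cat.
Qed.

Definition word_mul (f g : word_map) := WordMap (word_mul_subproof f g).

Definition word_inv (f : word_map) := word_of (rev (projT1 (cid (word_funP f)))).

Lemma word_invE (f : word_map) : cancel f (word_inv f) /\ cancel (word_inv f) f.
Proof.
rewrite /word_inv; case: cid => w /= fw; rewrite fw.
by split; [apply: word_act_rev|apply: word_act_revK].
Qed.

Lemma word_mulA : associative word_mul. Proof. by move=> f g h; apply: word_map_inj. Qed.
Lemma word_mul1 : left_id word_one word_mul. Proof. by move=> f; apply: word_map_inj. Qed.
Lemma word_1mul : right_id word_one word_mul. Proof. by move=> f; apply: word_map_inj. Qed.
Lemma word_mulV : left_inverse word_one word_inv word_mul.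
Proof. by move=> f; apply: word_map_inj; apply/funext => x; exact: (word_invE f).1. Qed.
Lemma word_Vmul : right_inverse word_one word_inv word_mul.
Proof. by move=> f; apply: word_map_inj; apply/funext => x; exact: (word_invE f).2. Qed.

Definition word_group : groupType := HB.pack word_map
  (isGroup.Build word_map word_mulA word_mul1 word_1mul word_mulV word_Vmul).

Lemma word_groupM (f g : word_group) : word_fun (f * g)%g = word_fun f \o word_fun g.
Proof. by []. Qed.

End WordGroup.

(* On a set covered by images of one finite type, each closed under the [t m],
   a word in the [t m] acts as it does on the finitely many possible images. *)
Lemma bounded_orbits_finite (X : Type) n (t : 'I_n -> X -> X) (I : finType) :
    (forall x, exists f : I -> X, (exists i, f i = x) /\
       forall m i, exists j, t m (f i) = f j) ->
  finite_set (range (word_act t)).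
Proof.
move=> cover.
pose table := {ffun 'I_n * I -> I}.
(* [ev w] lists the action of [w] under all conceivable transition tables on [I], among them the
   true one at any given point. *)
pose ev (w : seq 'I_n) : {ffun table * I -> I} :=
  [ffun c : table * I => foldr (fun m i => c.1 (m, i)) c.2 w].
have evP w w' : ev w = ev w' -> word_act t w = word_act t w'.
  move=> ww'; apply/funext => x; have [f [[i fi] fP]] := cover x.
  have /choice[r rP] : forall c : 'I_n * I, exists j, t c.1 (f c.2) = f j.
    by move=> [m j]; apply: fP.
  have E w0 : word_act t w0 x = f (ev w0 ([ffun c => r c], i)).
    rewrite ffunE /= -fi; elim: w0 => //= m w0 ->.
    by rewrite ffunE -rP.
  by rewrite !E ww'.
pose F e := if pselect (exists w, ev w = e) is left h then word_act t (projT1 (cid h)) else id.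
apply: (@sub_finite_set _ _ (F @` setT)); last exact/finite_image/finite_finset.
move=> _ [w _ <-]; exists (ev w) => //; rewrite /F; case: pselect => [h|[]]; last by exists w.
by case: cid => w' /= /evP.
Qed.

(** A finitely generated subgroup consists of words over the finitely many letters [T] that spell
    its generators. *)
Lemma word_group_locally_finite (X : Type) (gen : eqType) (act : gen -> X -> X)
    (actK : forall g, involutive (act g)) :
    (forall T : seq gen, exists I : finType, forall x, exists f : I -> X,
       (exists i, f i = x) /\ forall g, g \in T -> forall i, exists j, act g (f i) = f j) ->
  locally_finite (word_group actK).
Proof.
move=> bounded A /finite_seqP[s ->].
have /choice[w wP] := @word_ofP X gen act.
pose T := flatten (map w s).
pose t (m : 'I_(size T)) := act (tnth (in_tuple T) m).
have tK m : involutive (t m) by apply: actK.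
have finT : finite_set (range (word_act t)).
  have [I bI] := bounded T; apply: (bounded_orbits_finite (I := I)) => x.
  have [f [fx fP]] := bI x; exists f; split=> // m i.
  by apply: fP; apply: mem_tnth.
pose W := [set h : word_group actK | range (word_act t) (word_fun h)].
have finW : finite_set W.
  apply: card_le_finite finT; apply: (@card_le_inj _ _ _ _ (@word_fun _ _ _)) => //.
  by move=> h h' _ _ /word_map_inj.
apply: sub_finite_set finW; apply: smallest_sub.
  split; first by rewrite inE; exists [::].
  move=> f g; rewrite !inE => -[w1 _ fw1] [w2 _ gw2].
  exists (w1 ++ rev w2) => //; apply/funext => x.
  rewrite word_act_cat fw1 word_groupM /=; congr (word_fun f _).
  have [gV _] := word_invE actK g.
  have gr : word_fun g (word_act t (rev w2) x) = x by rewrite -gw2 (word_act_revK tK).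
  by rewrite -[LHS]gV gr.
move=> h /= hs.
have sub : {subset w h <= T}.
  by move=> g gw; apply/flattenP; exists (w h) => //; apply: map_f.
rewrite /W /= {1}[h]wP; elim: (w h) sub => [|g v IH] sub /=; first by exists [::].
have [|v' _ /= v'E] := IH; first by move=> g' g'v; apply: sub; rewrite inE g'v orbT.
have gT : g \in T by apply: sub; rewrite mem_head.
have gi : (index g T < size T)%N by rewrite index_mem.
exists (Ordinal gi :: v') => //; apply/funext => x /=.
by rewrite -v'E /t (tnth_nth g) /= nth_index.
Qed.

(** * The tower *)

Section Toggle.
Variable A : Type.
Implicit Types f g h : A -> bool.

Definition xorf f g : A -> bool := fun x => f x (+) g x.
Definition zerof : A -> bool := fun=> false.

Lemma xorfA f g h : xorf f (xorf g h) = xorf (xorf f g) h.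
Proof. by apply/funext => x; rewrite /xorf addbA. Qed.

Lemma xorfC f g : xorf f g = xorf g f.
Proof. by apply/funext => x; rewrite /xorf addbC. Qed.

Lemma xorfK f g : xorf (xorf f g) g = f.
Proof. by apply/funext => x; rewrite /xorf -addbA addbb addbF. Qed.

Lemma xorff f : xorf f f = zerof.
Proof. by apply/funext => x; rewrite /xorf addbb. Qed.

Lemma xor0f f : xorf zerof f = f.
Proof. by apply/funext => x; rewrite /xorf. Qed.

Lemma xorf_eq0 f g : xorf f g = zerof -> f = g.
Proof. by move=> fg; rewrite -[f](xorfK _ g) fg xor0f. Qed.

End Toggle.

Definition pointf (A : eqType) (a : A) : A -> bool := fun x => x == a.

Lemma pointf_inj (A : eqType) : injective (@pointf A).
Proof. by move=> a b /(congr1 (@^~ a)); rewrite /pointf eqxx => /esym/eqP. Qed.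

Section Span.
Variables (A : eqType) (I : finType).
Implicit Types (r : I -> option A) (B : {ffun I -> bool}).

(** The linear combination of the points [r i] with coefficients [B]; [None] stands for the zero
    vector. *)
Definition span r B : A -> bool :=
  fun x => \big[addb/false]_i (B i && (r i == Some x)).

Definition toggle B i : {ffun I -> bool} := [ffun j => B j (+) (j == i)].

Lemma span_add r B B' :
  span r [ffun i => B i (+) B' i] = xorf (span r B) (span r B').
Proof.
apply/funext => x; rewrite /xorf /span -big_split /=; apply: eq_bigr => i _.
by rewrite ffunE andb_addl.
Qed.

Lemma span_toggle r B i a : r i = Some a ->
  span r (toggle B i) = xorf (span r B) (pointf a).
Proof.
move=> ria; have -> : toggle B i = [ffun j => B j (+) [ffun j => j == i] j].
  by apply/ffunP => j; rewrite !ffunE.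
rewrite span_add; congr xorf; apply/funext => x; rewrite /span (bigD1 i) //=.
rewrite ffunE eqxx ria /= big1 ?addbF; last by move=> j ji; rewrite ffunE (negbTE ji).
by rewrite /pointf eq_sym.
Qed.

Lemma span0 r : span r [ffun=> false] = @zerof A.
Proof. by apply/funext => x; rewrite /span big1 // => i _; rewrite ffunE. Qed.

Lemma span_mem r B x : span r B x -> exists i, r i = Some x.
Proof.
move=> sx; apply: contrapT => nr; move: sx; rewrite /span big1 // => i _.
by apply/negbTE; rewrite negb_and; apply/orP; right; apply/eqP => ri; apply: nr; exists i.
Qed.

End Span.

(* Each level carries two registers, a set of pairs from ['I_k * L] and a set of
   elements of [L], and a bit.  [KE] translates the first register; where it is
   the code of a tuple [t], [KB] translates the second one by [O t]; where that
   one is a point [z], [KD] applies the lower generator named by [z].  [KH1] and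
   [KH2] flip the bit, and their commutators cut the action of the former down
   to the states with empty registers. *)
Inductive kind (k : nat) (L : Type) := KE of 'I_k & L | KB | KH1 | KD | KH2.
Arguments KB {k L}.
Arguments KH1 {k L}.
Arguments KD {k L}.
Arguments KH2 {k L}.

Section Tower.
Context {d : Order.disp_t} {Th : orderType d}.
Hypothesis wfTh : well_founded (fun x y : Th => x < y).
Variables (L : eqType) (k : nat) (O : ('I_k -> L) -> L).
Variables (Y Bs : Type) (rho : Bs -> Y -> Y).
Hypothesis rhoK : forall b, involutive (rho b).

Definition gen : Type := Bs + Th * kind k L.
HB.instance Definition _ := gen_eqMixin gen.

Variable s : L -> gen.

Definition cell : Type := ('I_k * L -> bool) * (L -> bool) * bool.
Definition state : Type := Y * (Th -> cell).
Implicit Types (a c : Th) (g : gen) (p q : state) (x : cell) (oa : option Th).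

Definition quiet x := x.1.1 = @zerof _ /\ x.1.2 = @zerof _.
Definition above g c : Prop := if g is inr (a, _) then a < c else True.
Definition below oa c : bool := if oa is Some a then c < a else true.
Definition gbelow oa g : bool := if g is inr (c, _) then below oa c else true.
Definition upd c x p : state := (p.1, fun a => if a == c then x else p.2 a).
Definition code (t : 'I_k -> L) : 'I_k * L -> bool := fun e => t e.1 == e.2.

Lemma code_inj t t' : code t = code t' -> t = t'.
Proof.
move=> tt'; apply/funext => i; apply/esym/eqP.
by have := congr1 (@^~ (i, t i)) tt'; rewrite /code /= eqxx => <-.
Qed.

Definition value (v : 'I_k * L -> bool) : option L :=
  if pselect (exists t, v = code t) is left h then Some (O (projT1 (cid h))) else None.

Lemma value_code t : value (code t) = Some (O t).
Proof.
rewrite /value; case: pselect => [h|[]]; last by exists t.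
by case: cid => t' /= /code_inj ->.
Qed.

Definition atom (w : L -> bool) : option L :=
  if pselect (exists z, w = @pointf L z) is left h then Some (projT1 (cid h)) else None.

Lemma atom_point z : atom (@pointf L z) = Some z.
Proof.
rewrite /atom; case: pselect => [h|[]]; last by exists z.
by case: cid => z' /= /pointf_inj ->.
Qed.

Lemma atomP w z : atom w = Some z -> w = @pointf L z.
Proof. by rewrite /atom; case: pselect => // h [<-]; case: cid. Qed.

(** [KB] and [KD] act only while the bit is off. In a commutator with a flip of the bit, such an
    involution, if it preserves the condition of the flip, is applied once where the flip takes
    place and cancels elsewhere. *)
Definition level_act c (low : gen -> state -> state) (kd : kind k L) p : state :=
  let: (v, w, b) := p.2 c in
  match kd with
  | KE m z => upd c (xorf v (pointf (m, z)), w, b) p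
  | KB => if value v is Some z then
            if b then p else upd c (v, xorf w (@pointf L z), b) p
          else p
  | KH1 => if `[< v = @zerof _ >] then upd c (v, w, ~~ b) p else p
  | KD => if atom w is Some z then
            if `[< v = @zerof _ >] && ~~ b then low (s z) p else p
          else p
  | KH2 => if `[< v = @zerof _ /\ w = @zerof _ >] then upd c (v, w, ~~ b) p else p
  end.

(* [g] acts within the levels selected by [oa]: only where all the levels
   between that of [g] and [oa] are quiet. *)
Definition active oa g p : Prop :=
  gbelow oa g /\ forall c, above g c -> below oa c -> quiet (p.2 c).

Definition raw_of (F : Th -> kind k L -> state -> state) g p : state :=
  match g with inl b => (rho b p.1, p.2) | inr (c, kd) => F c kd p end.

Definition sub_of F oa g p : state :=
  if `[< active oa g p >] then raw_of F g p else p.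

(** Recursion on the level: [active (Some c)] admits only base generators and levels below [c]. *)
Lemma raw_ex : exists F, forall c, F c = level_act c (sub_of F (Some c)).
Proof.
have [F FE] := @wf_rec _ _ wfTh (kind k L -> state -> state) (fun c rec =>
  level_act c (fun g p => if `[< active (Some c) g p >] then
    match g with
    | inl b => (rho b p.1, p.2)
    | inr (a, kd) => if pselect (a < c) is left h then rec a h kd p else p
    end else p)).
exists F => c; rewrite FE; congr level_act; apply/funext => g; apply/funext => p.
rewrite /sub_of; case: asboolP => //; case: g => [//|[a kd]] [/= ac _].
by case: pselect.
Qed.

Definition raw := raw_of (projT1 (cid raw_ex)).
Definition sub := sub_of (projT1 (cid raw_ex)).

Lemma rawE c kd : raw (inr (c, kd)) = level_act c (sub (Some c)) kd.
Proof.
rewrite /raw /sub; case: cid => F FE; apply/funext => p.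
by rewrite /raw_of /= FE.
Qed.

Lemma subE oa g p : active oa g p -> sub oa g p = raw g p.
Proof. by rewrite /sub /sub_of => ac; rewrite asboolT. Qed.

Lemma sub_id oa g p : ~ active oa g p -> sub oa g p = p.
Proof. by rewrite /sub /sub_of => ac; rewrite asboolF. Qed.

Lemma updE c x p : (upd c x p).2 c = x.
Proof. by rewrite /= eqxx. Qed.

Lemma updN c x p a : a != c -> (upd c x p).2 a = p.2 a.
Proof. by rewrite /= => /negbTE ->. Qed.

Lemma upd_upd c x y p : upd c x (upd c y p) = upd c x p.
Proof. by congr pair; apply/funext => a /=; case: eqP. Qed.

Lemma updC a c x y p : a != c -> upd a x (upd c y p) = upd c y (upd a x p).
Proof.
move=> ac; congr pair; apply/funext => b /=; case: eqP => // ->.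
by rewrite (negbTE ac).
Qed.

Lemma upd_id c p : upd c (p.2 c) p = p.
Proof. by case: p => y p; congr pair; apply/funext => a /=; case: eqP => // ->. Qed.

Lemma upd_idE c x p : p.2 c = x -> upd c x p = p.
Proof. by move=> <-; apply: upd_id. Qed.

(** The first two clauses say that [low g] neither changes nor reads the levels in [P]. *)
Definition tame (low : gen -> state -> state) (P : Th -> Prop) g :=
  [/\ forall p c, P c -> (low g p).2 c = p.2 c,
      forall p c x, P c -> low g (upd c x p) = upd c x (low g p)
    & involutive (low g)].

Lemma not_below_above oa g c : gbelow oa g -> ~~ below oa c -> above g c.
Proof.
case: g => [//|[a kd]] /=; case: oa => [b|//] /= ab; rewrite -leNgt.
exact: lt_le_trans.
Qed.

(** Whether [g] is active depends on levels that [raw g] leaves alone, so the restriction remains an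
    involution. *)
Lemma tame_sub oa g : tame raw (above g) g ->
  tame (sub oa) (fun c => ~~ below oa c) g.
Proof.
move=> [frame updr rK]; split.
- move=> p c nb; have [ac|nac] := pselect (active oa g p); last by rewrite sub_id.
  by rewrite subE // frame //; case: ac => gb _; apply: not_below_above nb.
- move=> p c x nb.
  have acE q : (forall a, below oa a -> q.2 a = p.2 a) -> active oa g q <-> active oa g p.
    by move=> qp; split=> -[gb ac]; split=> // a ga ba; [rewrite -qp|rewrite qp] => //; apply: ac.
  have pu : active oa g (upd c x p) <-> active oa g p.
    apply: acE => a ba; rewrite updN //; apply/eqP => ac.
    by move: nb; rewrite -ac ba.
  have [ac|nac] := pselect (active oa g p); last by rewrite !sub_id // pu.
  rewrite !subE //; last exact/pu.
  by rewrite updr //; case: ac => gb _; apply: not_below_above nb.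
move=> p; have [ac|nac] := pselect (active oa g p); last by rewrite !sub_id.
rewrite (subE ac) subE ?rK //; case: ac => gb ac; split=> // c gc bc.
by rewrite frame //; apply: ac.
Qed.

(** Induction on the level. The generator called by [KD] leaves cell [c] alone, so a second [KD]
    calls the same one. *)
Lemma tame_raw g : tame raw (above g) g.
Proof.
case: g => [b|[c kd]].
  by split=> [p c _ //|p c x _ //|[y p]]; rewrite /raw /= rhoK.
elim/(wf_ind wfTh): c kd => c IH kd.
have low g : tame (sub (Some c)) (fun a => ~~ (a < c)) g.
  have [gb|ngb] := boolP (gbelow (Some c) g).
    apply: tame_sub; case: g gb => [b _|[a kd'] /= ac]; last exact: IH.
    by split=> [p a _ //|p a x _ //|[y p]]; rewrite /raw /= rhoK.
  have sid p : sub (Some c) g p = p.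
    by apply: sub_id => -[]; rewrite (negbTE ngb).
  by split=> [p a _|p a x _|p]; rewrite !sid.
rewrite /tame rawE; split=> [p a /= ca|p a x /= ca|p].
- rewrite /level_act; case: (p.2 c) => -[v w] b.
  have upd_a y : (upd c y p).2 a = p.2 a by rewrite updN // gt_eqF.
  case: kd => [m z||||] //.
  + by case: (value v) => // z; case: b.
  + by case: ifP.
  + case: (atom w) => // z; case: ifP => // _.
    by have [-> //] := low (s z); rewrite -leNgt ltW.
  + by case: ifP.
- have ac : c != a by rewrite lt_eqF.
  rewrite /level_act updN //; case: (p.2 c) => -[v w] b.
  case: kd => [m z||||]; rewrite ?[upd c _ (upd a _ _)]updC //.
  + by case: (value v) => [z|//]; case: b => //; rewrite updC.
  + by case: ifP.
  + case: (atom w) => // z; case: ifP => // _.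
    by have [_ -> //] := low (s z); rewrite -leNgt ltW.
  + by case: ifP.
rewrite /level_act; case E : (p.2 c) => [[v w] b].
case: kd => [m z||||].
- by rewrite updE upd_upd xorfK -E upd_id.
- case V : (value v) => [z|]; last by rewrite E V.
  by case: b E => E; [rewrite E V|rewrite updE V upd_upd xorfK -E upd_id].
- case: ifP => V; last by rewrite E V.
  by rewrite updE V upd_upd negbK -E upd_id.
- case W : (atom w) => [z|]; last by rewrite E W.
  case: ifP => V; last by rewrite E W V.
  have [frame _ sK] := low (s z).
  by rewrite frame ?ltxx // E W V sK.
- case: ifP => V; last by rewrite E V.
  by rewrite updE V upd_upd negbK -E upd_id.
Qed.

Definition act g : state -> state := sub None g.

Lemma subK oa g : involutive (sub oa g).
Proof. by have [] := tame_sub oa (tame_raw g). Qed.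

Lemma actK g : involutive (act g). Proof. exact: subK. Qed.

Lemma sub_frame oa g p c : ~~ below oa c -> (sub oa g p).2 c = p.2 c.
Proof. by have [+ _ _] := tame_sub oa (tame_raw g); apply. Qed.

Lemma sub_upd oa g p c x : ~~ below oa c -> sub oa g (upd c x p) = upd c x (sub oa g p).
Proof. by have [_ + _] := tame_sub oa (tame_raw g); apply. Qed.

Definition active_at c p := forall a, c < a -> quiet (p.2 a).

(** All kinds but [KD] alter one cell as a function of itself, so words in them reduce to composing
    functions on [cell]. *)
Definition cell_act c (h : cell -> cell) p : state :=
  if `[< active_at c p >] then upd c (h (p.2 c)) p else p.

Lemma active_at_upd c x p : active_at c (upd c x p) <-> active_at c p.
Proof.
by split=> ac a ca; have := ac a ca; rewrite updN // gt_eqF.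
Qed.

Lemma cell_actE c h p : active_at c p -> cell_act c h p = upd c (h (p.2 c)) p.
Proof. by move=> ac; rewrite /cell_act asboolT. Qed.

Lemma cell_act_off c h p : ~ active_at c p -> cell_act c h p = p.
Proof. by move=> ac; rewrite /cell_act asboolF. Qed.

Lemma cell_act_comp c h h' : cell_act c h \o cell_act c h' = cell_act c (h \o h').
Proof.
apply/funext => p /=; have [ac|nac] := pselect (active_at c p); last by rewrite !cell_act_off.
rewrite (cell_actE h' ac) cell_actE ?updE ?upd_upd ?cell_actE //; exact/active_at_upd.
Qed.

Lemma cell_act_id c : cell_act c id = id.
Proof.
apply/funext => p; have [ac|nac] := pselect (active_at c p); last by rewrite cell_act_off.
by rewrite cell_actE // upd_id.
Qed.

Lemma act_on c kd p : active_at c p ->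
  act (inr (c, kd)) p = level_act c (sub (Some c)) kd p.
Proof. by move=> ac; rewrite /act subE ?rawE //; split=> // a /= ca _; apply: ac. Qed.

Lemma act_off c kd p : ~ active_at c p -> act (inr (c, kd)) p = p.
Proof. by move=> nac; apply: sub_id => -[_ ac]; apply: nac => a ca; apply: ac. Qed.

Definition flipE (f : 'I_k * L -> bool) x : cell := (xorf x.1.1 f, x.1.2, x.2).
Definition flipB x : cell :=
  if value x.1.1 is Some z then
    if x.2 then x else (x.1.1, xorf x.1.2 (@pointf L z), x.2)
  else x.
Definition flipH1 x : cell := if `[< x.1.1 = @zerof _ >] then (x.1, ~~ x.2) else x.
Definition flipH2 x : cell := if `[< quiet x >] then (x.1, ~~ x.2) else x.

Lemma act_cell c kd h :
    (forall p, level_act c (sub (Some c)) kd p = upd c (h (p.2 c)) p) ->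
  act (inr (c, kd)) = cell_act c h.
Proof.
move=> hE; apply/funext => p.
have [ac|nac] := pselect (active_at c p); last by rewrite act_off ?cell_act_off.
by rewrite act_on // hE cell_actE.
Qed.

Lemma act_E c m z : act (inr (c, KE m z)) = cell_act c (flipE (pointf (m, z))).
Proof. by apply: act_cell => p; rewrite /level_act /flipE; case: (p.2 c) => [[v w] b]. Qed.

Lemma act_B c : act (inr (c, KB)) = cell_act c flipB.
Proof.
apply: act_cell => p; rewrite /level_act /flipB; case E : (p.2 c) => [[v w] b] /=.
by case: (value v) => [z|]; [case: b E => E|]; rewrite // -E upd_id.
Qed.

Lemma act_H1 c : act (inr (c, KH1)) = cell_act c flipH1.
Proof.
apply: act_cell => p; rewrite /level_act /flipH1; case E : (p.2 c) => [[v w] b] /=.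
by case: ifP; rewrite // -E upd_id.
Qed.

Lemma act_H2 c : act (inr (c, KH2)) = cell_act c flipH2.
Proof.
apply: act_cell => p; rewrite /level_act /flipH2; case E : (p.2 c) => [[v w] b] /=.
by rewrite /quiet /=; case: ifP; rewrite // -E upd_id.
Qed.

(** * Generating lower letters by commutators *)

Section Generated.
Variable M : set (state -> state).
Hypothesis M1 : M id.
Hypothesis Mcomp : forall f g : state -> state, M f -> M g -> M (f \o g).
Variables (c : Th) (t : 'I_k -> L).
Hypothesis ME : forall m, M (act (inr (c, KE m (t m)))).
Hypothesis MB : M (act (inr (c, KB))).
Hypothesis MH1 : M (act (inr (c, KH1))).
Hypothesis MD : M (act (inr (c, KD))).
Hypothesis MH2 : M (act (inr (c, KH2))).

(** Each [KE m (t m)] toggles one point of the graph of [t]; together they toggle [code t]. *)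
Lemma translation_generated : M (cell_act c (flipE (code t))).
Proof.
suff tr (ms : seq 'I_k) : uniq ms ->
    M (cell_act c (flipE (fun e => (e.1 \in ms) && (t e.1 == e.2)))).
  have := tr _ (enum_uniq 'I_k); congr (M (cell_act c (flipE _))).
  by apply/funext => e; rewrite mem_enum.
elim: ms => [_|m ms IH /= /andP[nm ums]].
  rewrite (_ : flipE _ = id) ?cell_act_id //; apply/funext => -[[v w] b].
  by congr (_, _, _); apply/funext => e; rewrite /xorf /= addbF.
have := Mcomp (ME m) (IH ums); rewrite act_E cell_act_comp; congr (M (cell_act c _)).
apply/funext => -[[v w] b]; congr (_, _, _); apply/funext => e.
rewrite /xorf /pointf -addbA; congr (_ (+) _); case: e => m' z; rewrite xpair_eqE inE /=.
have [->|nmm] := eqVneq m' m; first by rewrite (negbTE nm) /= eq_sym.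
by rewrite addbF.
Qed.

Definition flipZ x : cell :=
  if `[< x.1.1 = @zerof _ >] then (x.1.1, xorf x.1.2 (@pointf L (O t)), x.2) else x.

Lemma flipZK : involutive flipZ.
Proof.
move=> [[v w] b]; rewrite /flipZ /=.
by case: (asboolP (v = _)) => V /=; rewrite ?(asboolT V) ?(asboolF V) // xorfK.
Qed.

(* the commutator of [KH1] with the conjugate of [KB] by the translation [code t] *)
Lemma flipZ_generated : M (cell_act c flipZ).
Proof.
have tr := translation_generated.
have b' := Mcomp tr (Mcomp MB tr); have := Mcomp b' (Mcomp MH1 (Mcomp b' MH1)).
rewrite act_B act_H1 !cell_act_comp; congr (M (cell_act c _)).
pose h := flipE (code t) \o (flipB \o flipE (code t)).
have hb (v : 'I_k * L -> bool) (w : L -> bool) (b : bool) :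
    h (v, w, b) =
    (v, if value (xorf v (code t)) is Some z then if b then w else xorf w (@pointf L z) else w, b).
  rewrite /h /flipE /flipB /=; case: (value _) => [z|]; last by rewrite /= xorfK.
  by case: b; rewrite /= xorfK.
apply/funext => -[[v w] b]; rewrite -[LHS]/(h (flipH1 (h (flipH1 (v, w, b))))) /flipZ /=.
have H1E (w1 : L -> bool) b1 : flipH1 (v, w1, b1) = (v, w1, if `[< v = @zerof _ >] then ~~ b1 else b1).
  by rewrite /flipH1 /=; case: ifP.
(* With [v] empty the conjugate sees [code t], hence [O t], and one of its two applications meets
   the bit off. Otherwise the bit stays put and they cancel. *)
rewrite H1E hb H1E hb; case: asboolP => [->|nv].
  by rewrite xor0f value_code; case: b.
by case: (value _) => // z; case: b => //; rewrite xorfK.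
Qed.

(** Conjugated by [flipZ], [KD] calls [s (O t)] where both registers are empty; the commutator with
    [KH2] removes the dependence on the bit and the effect on states where cell [c] is not quiet.
    The letter itself acts only where [c] is quiet. *)
Lemma act_generated : gbelow (Some c) (s (O t)) -> M (act (s (O t))).
Proof.
set z := O t => sc; set S := sub (Some c) (s z).
pose Z := cell_act c flipZ.
have ZK : Z \o Z = id.
  by rewrite /Z cell_act_comp (_ : flipZ \o flipZ = id) ?cell_act_id //; apply/funext/flipZK.
pose D := act (inr (c, KD)); pose D' := Z \o (D \o Z).
have MD' : M D' by apply: Mcomp; [|apply: Mcomp]; do ?exact: flipZ_generated.
suff -> : act (s z) = D' \o (act (inr (c, KH2)) \o (D' \o act (inr (c, KH2)))).
  by do ?[apply: Mcomp => //].
have ZKp p : Z (Z p) = p by rewrite -[RHS]/(id p) -ZK.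
have D'K p : D' (D' p) = p by rewrite /D' /= ZKp (actK (inr (c, KD)) : involutive D) ZKp.
have above_sz a : c <= a -> above (s z) a.
  by move=> ca; apply: not_below_above sc _; rewrite /= -leNgt.
apply/funext => p; rewrite act_H2.
rewrite -[RHS]/(D' (cell_act c flipH2 (D' (cell_act c flipH2 p)))).
have [ac|nac] := pselect (active_at c p); last first.
  have D'p : D' p = p by rewrite /D' /= /Z (cell_act_off _ nac) /D act_off // cell_act_off.
  rewrite !(cell_act_off _ nac, D'p); apply: sub_id => -[_ h]; apply: nac => a ca.
  by apply: h => //; apply/above_sz/ltW.
have Dframe q a : ~~ (a < c) -> (D q).2 a = q.2 a.
  move=> na; have [aq|naq] := pselect (active_at c q); last by rewrite /D act_off.
  rewrite /D act_on // /level_act; case: (q.2 c) => [[v w] b].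
  by case: (atom w) => // z'; case: ifP => // _; rewrite sub_frame.
have D'c q : active_at c q -> active_at c (D' q) /\ (D' q).2 c = q.2 c.
  move=> aq; have aDZ : active_at c (D (Z q)).
    move=> a ca; rewrite Dframe -?leNgt ?ltW //.
    by rewrite /Z cell_actE // updN ?gt_eqF //; apply: aq.
  rewrite /D' /= /Z cell_actE //; split; first exact/active_at_upd.
  by rewrite updE Dframe ?ltxx // cell_actE // updE flipZK.
have [quiet_p|nq] := pselect (quiet (p.2 c)); last first.
  have H2id q : active_at c q -> q.2 c = p.2 c -> cell_act c flipH2 q = q.
    by move=> aq qc; rewrite cell_actE // qc /flipH2 asboolF // -qc upd_id.
  have [aD'p D'pc] := D'c p ac.
  rewrite (H2id p) // (H2id (D' p)) // D'K; apply: sub_id => -[_ h].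
  by apply: nq; apply: h => //; apply: above_sz.
have D'quiet q b : active_at c q ->
    D' (upd c (@zerof _, @zerof _, b) q) =
    upd c (@zerof _, @zerof _, b) (if b then q else S q).
  move=> aq; have aqu x : active_at c (upd c x q) by exact/active_at_upd.
  rewrite /D' /= /Z (cell_actE _ (aqu _)) updE upd_upd.
  rewrite {2}/flipZ /= asboolT // xor0f /D (act_on _ (aqu _)).
  rewrite /level_act updE atom_point asboolT //=.
  have aS : active_at c (S q).
    by move=> a ca; rewrite /S sub_frame ?[~~ _]/= -?leNgt ?ltW //; apply: aq.
  have aSu x : active_at c (upd c x (S q)) by exact/active_at_upd.
  case: b => /=.
    rewrite cell_actE; last exact: aqu.
    by rewrite updE upd_upd /flipZ /= asboolT // xorff.
  rewrite sub_upd /= ?ltxx // cell_actE; last exact: aSu.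
  by rewrite updE upd_upd /flipZ /= asboolT // xorff.
have [b pc] : exists b, p.2 c = (@zerof _, @zerof _, b).
  by move: quiet_p; case: (p.2 c) => [[v w] b] [/= -> ->]; exists b.
have H2q b' q : active_at c q -> cell_act c flipH2 (upd c (@zerof _, @zerof _, b') q) =
    upd c (@zerof _, @zerof _, ~~ b') q.
  move=> aq; rewrite cell_actE; last exact/active_at_upd.
  by rewrite updE upd_upd /flipH2 asboolT.
have aS : active_at c (S p).
  by move=> a ca; rewrite /S sub_frame ?[~~ _]/= -?leNgt ?ltW //; apply: ac.
(* All levels from [c] on are quiet at [p], so for [s z] being active below [c] is the same as being
   active outright. *)
have actS : act (s z) p = S p.
  have [aS'|naS] := pselect (active (Some c) (s z) p).
    rewrite /S (subE aS') /act subE //; split=> [|a sza _]; first by case: (s z) => [|[]].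
    case: (ltgtP a c) => [ac'|ca|->] //; last exact: ac.
    by case: aS' => _; apply.
  rewrite /S (sub_id naS) /act sub_id // => -[_ h]; apply: naS; split=> // a sza ac'.
  exact: h.
rewrite actS -{2}(upd_idE pc) H2q // D'quiet // H2q; last by case: (~~ b).
rewrite negbK D'quiet; last by case: (~~ b).
case: b pc => /= pc; rewrite upd_idE //.
  by rewrite /S sub_frame //= ltxx.
by rewrite /S sub_frame //= ltxx.
Qed.

End Generated.

(** * Uniformly bounded orbits *)

Hypothesis rho_bounded : forall T : seq gen, exists I : finType, forall y,
  exists f : I -> Y, (exists i, f i = y) /\
    forall b, (inl b : gen) \in T -> forall i, exists j, rho b (f i) = f j.

(** [f] may list states repeatedly, so that one finite [I] can serve all [p]. *)
Definition orbit_bound oa (T : seq gen) (I : Type) p (f : I -> state) :=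
  [/\ exists i, f i = p, forall i c, ~~ below oa c -> (f i).2 c = p.2 c
    & forall g, g \in T -> forall i, exists j, sub oa g (f i) = f j].

Section Assemble.
Variables (oa : option Th) (T : seq gen) (c : Th).
Hypothesis oac : below oa c.
Hypothesis Tc : forall a kd, (inr (a, kd) : gen) \in T -> a <= c.

Definition shifts : seq ('I_k * L) :=
  pmap (fun g => if g is inr (a, KE m z) then
    if a == c then Some (m, z) else None else None) T.

Definition shift (i : 'I_(size shifts)) : option ('I_k * L) :=
  Some (tnth (in_tuple shifts) i).

Local Notation AT := {ffun 'I_(size shifts) -> bool}.
Local Notation BT := {ffun AT -> bool}.

Definition colour (v0 : 'I_k * L -> bool) (A : AT) : option L :=
  value (xorf v0 (span shift A)).

Variable p : state.
Hypothesis quiet_above : forall a, c < a -> below oa a -> quiet (p.2 a).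
Let v0 := (p.2 c).1.1.
Let w0 := (p.2 c).1.2.
Let vA A := xorf v0 (span shift A).
Let wB B := xorf w0 (span (colour v0) B).

(** The registers of cell [c] stay in the cosets of [v0] by the shifts and of [w0] by the colours;
    [A], [B] and a bit are coordinates there, and [J] lists the lower levels. Those move only when
    both registers are empty or when [KD] reads a point, which the last two hypotheses cover. *)
Lemma orbit_assemble (J : Type) (psi : J -> state) :
    (exists j, psi j = p) ->
    (forall j a, ~~ (a < c) -> (psi j).2 a = p.2 a) ->
    (forall g, g \in T -> gbelow (Some c) g -> forall A B,
      vA A = @zerof _ -> wB B = @zerof _ ->
      forall j, exists j', sub (Some c) g (psi j) = psi j') ->
    (forall z A B, vA A = @zerof _ -> wB B = pointf z ->
      forall j, exists j', sub (Some c) (s z) (psi j) = psi j') ->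
  exists f : J * AT * BT * bool -> state, orbit_bound oa T p f.
Proof.
move=> [j0 psi_p] frame low lowD.
pose f (x : J * AT * BT * bool) := upd c (vA x.1.1.2, wB x.1.2, x.2) (psi x.1.1.1).
exists f; split.
- exists (j0, [ffun=> false], [ffun=> false], (p.2 c).2); rewrite /f /= psi_p.
  apply: upd_idE; rewrite /vA /wB !span0 /v0 /w0.
  by rewrite -![xorf _ (@zerof _)]xorfC !xor0f; case: (p.2 c) => [[]].
- move=> [[[j A] B] b] a na; rewrite /f updN ?frame //; last first.
    by apply/eqP => ac; move: na; rewrite ac oac.
  apply/negP => ac; move: na; case: oa oac => [e|//] /= ce.
  by rewrite (lt_trans ac ce).
move=> g gT [[[j A] B] b]; set x := (j, A, B, b).
have [gc|ngc] := boolP (gbelow (Some c) g).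
  have [ac|nac] := pselect (active oa g (f x)); last by exists x; rewrite sub_id.
  have abc : above g c by case: g gc {gT ac} => [//|[a kd]].
  have [vA0 wB0] : quiet ((f x).2 c) by case: ac => _; apply.
  rewrite /f /= eqxx /= in vA0 wB0.
  have [j' jj'] := low g gT gc A B vA0 wB0 j.
  exists (j', A, B, b); rewrite subE // -[RHS]/(upd c (vA A, wB B, b) (psi j')) -jj'.
  rewrite -sub_upd /= ?ltxx // subE //; split=> // a ga ac'.
  by case: ac => _; apply=> //; case: oa oac => [e|//] /=; apply: lt_trans.
case: g gT ngc => [//|[a kd]] gT /=; rewrite -leNgt => ca.
have {ca} ac : a = c by apply/eqP; rewrite eq_le ca (Tc gT).
subst a; have act_x : active oa (inr (c, kd)) (f x).
  by split=> // a ca oaa; rewrite /f updN ?gt_eqF // frame -?leNgt ?ltW //; apply: quiet_above.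
rewrite subE // rawE /level_act {1}/f updE.
have fE v w b' y : f y = upd c (v, w, b') (psi j) -> f y = upd c (v, w, b') (f x).
  by move=> ->; rewrite /f upd_upd.
case: kd gT {act_x} => [m z||||] gT.
- have mz : (m, z) \in shifts.
    rewrite /shifts; elim: T gT => //= g T' IH; rewrite inE => /orP[/eqP <-|/IH mz].
      by rewrite eqxx /= mem_head.
    by case: (if g is inr _ then _ else _) => [e|//] /=; rewrite inE mz orbT.
  have iP : (index (m, z) shifts < size shifts)%N by rewrite index_mem.
  exists (j, toggle A (Ordinal iP), B, b); apply/esym/fE; rewrite /f /=.
  congr (upd c (_, _, _) _); rewrite /vA (@span_toggle _ _ _ _ _ (m, z)) ?xorfA //.
  by rewrite /shift (tnth_nth (m, z)) /= nth_index.
- case V : (value (vA A)) => [z|]; last by exists x.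
  case: b @x fE => x fE; first by exists x.
  exists (j, A, toggle B A, false); apply/esym/fE; rewrite /f /=.
  by congr (upd c (_, _, _) _); rewrite /wB (@span_toggle _ _ _ _ _ z) ?xorfA.
- case: ifP => _; last by exists x.
  by exists (j, A, B, ~~ b); apply/esym/fE.
- case W : (atom (wB B)) => [z|]; last by exists x.
  case: ifP => [/andP[/asboolP vA0 _]|_]; last by exists x.
  have [j' jj'] := lowD z A B vA0 (atomP W) j.
  by exists (j', A, B, b); rewrite /f sub_upd /= ?ltxx // jj'.
- case: ifP => _; last by exists x.
  by exists (j, A, B, ~~ b); apply/esym/fE.
Qed.

End Assemble.

Lemma max_level (T : seq gen) : (forall a kd, (inr (a, kd) : gen) \notin T) \/
  exists c, (exists kd, (inr (c, kd) : gen) \in T) /\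
    forall a kd, (inr (a, kd) : gen) \in T -> a <= c.
Proof.
elim: T => [|g T [none|[c [[kd0 cT] cmax]]]]; first by left.
- case: g => [b|[a kd]].
    by left=> a kd; rewrite inE negb_or none andbT; apply/eqP.
  right; exists a; split; first by exists kd; rewrite mem_head.
  by move=> a' kd'; rewrite inE => /orP[/eqP[-> _] //|]; rewrite (negbTE (none _ _)).
right; case: g => [b|[a kd]].
  exists c; split; first by exists kd0; rewrite inE cT orbT.
  by move=> a kd; rewrite inE => /orP[/eqP//|]; apply: cmax.
exists (Order.max a c); split.
  case: (leP a c) => _; first by exists kd0; rewrite inE cT orbT.
  by exists kd; rewrite mem_head.
move=> a' kd'; rewrite inE le_max => /orP[/eqP[-> _]|/cmax ->]; first by rewrite lexx.
by rewrite orbT.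
Qed.

Lemma orbit_bound_const oa T p : (forall g, g \in T -> ~ active oa g p) ->
  forall I : Type, inhabited I -> orbit_bound oa T p (fun _ : I => p).
Proof.
move=> nac I [i0]; split=> [|//|g gT i]; first by exists i0.
by exists i; rewrite sub_id //; apply: nac.
Qed.

(* The involutions occurring at the top level of [T] move the coset of a point
   through finitely many cells; the lower generators met there are those of [T]
   and those named by the codes in the span of the shifts, or, off this span, at
   most one further involution. *)
Lemma orbit_bound_step oa :
    (forall c, below oa c -> forall T, (forall g, g \in T -> gbelow (Some c) g) ->
      exists I : finType, forall p, exists f : I -> state, orbit_bound (Some c) T p f) ->
  forall T, (forall g, g \in T -> gbelow oa g) ->
    exists I : finType, forall p, exists f : I -> state, orbit_bound oa T p f.
Proof.
move=> IH T Toa; have [noT|[c [[kd0 cT] cmax]]] := max_level T.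
  have [I IP] := rho_bounded T; exists I => p.
  have [f [[i0 fi0] fP]] := IP p.1.
  have [ac|nac] := pselect (forall a, below oa a -> quiet (p.2 a)); last first.
    exists (fun=> p); apply: orbit_bound_const; last exact: (inhabits i0).
    move=> [b|[a kd]] gT; last by move: gT; rewrite (negbTE (noT _ _)).
    by move=> [_ h]; apply: nac => a; apply: h.
  exists (fun i => (f i, p.2)); split=> [|//|[b|[a kd]] gT i].
  - by exists i0; rewrite fi0; case: (p).
  - have [j bj] := fP b gT i; exists j; rewrite subE //; last by split=> // a _; apply: ac.
    by rewrite /raw /= bj.
  - by move: gT; rewrite (negbTE (noT _ _)).
have oac : below oa c by have := Toa _ cT.
(* [Gamma] must not depend on [p], so colours are taken over [zerof]. If the first register can be
   emptied, [v0] lies in the span and the actual colours are among these, by [colourG]. *)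
pose Gamma := pmap (@colour T c (@zerof _)) (enum {ffun 'I_(size (shifts T c)) -> bool}).
pose T' := [seq g <- T ++ map s Gamma | gbelow (Some c) g].
have [|I IP] := IH c oac T'; first by move=> g; rewrite mem_filter => /andP[].
(* [I] serves the orbits below [c], [bool] the two states exchanged by one further involution. *)
pose J : finType := (I + bool)%type.
exists (J * {ffun 'I_(size (shifts T c)) -> bool} *
  {ffun {ffun 'I_(size (shifts T c)) -> bool} -> bool} * bool)%type => p.
have [f [[i0 fi0] frame fP]] := IP p.
have [quiet_above|nq] := pselect (forall a, c < a -> below oa a -> quiet (p.2 a)); last first.
  exists (fun=> p); apply: orbit_bound_const; last first.
    by constructor; exact: (inr true, [ffun=> false], [ffun=> false], true).
  move=> g gT [_ h]; apply: nq => a ca; apply: h.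
  by case: g gT => [//|[a' kd]] /cmax /=; move=> /le_lt_trans; apply.
set v0 := (p.2 c).1.1; set w0 := (p.2 c).1.2.
have sub_notbelow g q : ~~ gbelow (Some c) g -> sub (Some c) g q = q.
  by move=> ng; apply: sub_id => -[]; rewrite (negbTE ng).
have colourG A0 : xorf v0 (span (@shift T c) A0) = @zerof _ ->
    forall A z, @colour T c v0 A = Some z -> z \in Gamma.
  move=> /xorf_eq0 v0E A z; rewrite /colour v0E -span_add => Az.
  by rewrite mem_pmap; apply/mapP; exists [ffun i => A0 i (+) A i];
    rewrite ?mem_enum // /colour xor0f Az.
have [[A0 vA0]|nvA] := pselect (exists A, xorf v0 (span (@shift T c) A) = @zerof _); last first.
  apply: (@orbit_assemble oa T c oac cmax p quiet_above J (fun=> p)) => //.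
  - by exists (inr true).
  - by move=> g _ _ A B vA0; case: nvA; exists A.
  - by move=> z A B vA0; case: nvA; exists A.
pose wB (B : {ffun {ffun 'I_(size (shifts T c)) -> bool} -> bool}) :=
  xorf w0 (span (@colour T c v0) B).
(* If the second register can be emptied, [w0] is a sum of colours; a point [z] that it may become
   is then a colour, so [s z] is in [T'] unless it is not below [c]. *)
have [[B0 wB0]|nwB] := pselect (exists B, wB B = @zerof _).
  pose psi (x : J) := if x is inl i then f i else f i0.
  have psi_f (y : J) : exists i, psi y = f i by case: y => [i|b]; [exists i|exists i0].
  have closed g : g \in T' -> forall y : J, exists y', sub (Some c) g (psi y) = psi y'.
    by move=> gT x; have [i ->] := psi_f x; have [j fj] := fP g gT i; exists (inl j).
  apply: (@orbit_assemble oa T c oac cmax p quiet_above J psi).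
  - by exists (inl i0).
  - by move=> x a na; have [i ->] := psi_f x; apply: frame.
  - by move=> g gT gc A B _ _; apply: closed; rewrite mem_filter gc mem_cat gT.
  move=> z A B _ wBz x; have [sc|nsc] := boolP (gbelow (Some c) (s z)); last first.
    by exists x; rewrite sub_notbelow.
  apply: closed; rewrite mem_filter sc mem_cat; apply/orP; right; apply: map_f.
  have w0E := xorf_eq0 wB0.
  have : span (@colour T c v0) [ffun A => B0 A (+) B A] z.
    by rewrite span_add -w0E (wBz : xorf w0 (span (@colour T c v0) B) = _) /pointf eqxx.
  by move=> /span_mem[A1]; apply: colourG vA0 A1 z.
have [[z1 [B1 wBz1]]|nz] := pselect (exists z B, wB B = pointf z); last first.
  apply: (@orbit_assemble oa T c oac cmax p quiet_above J (fun=> p)) => //.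
  - by exists (inr true).
  - by move=> g _ _ A B _ wB0; case: nwB; exists B.
  - by move=> z A B _ wBz; case: nz; exists z, B.
pose psi (x : J) := if x is inr true then sub (Some c) (s z1) p else p.
apply: (@orbit_assemble oa T c oac cmax p quiet_above J psi).
- by exists (inr false).
- by move=> [i|[]] a na //; apply: sub_frame.
- by move=> g _ _ A B _ wB0; case: nwB; exists B.
(* Distinct points [z] and [z1] in the coset differ by a sum of colours, so [z] is a colour, and
   toggling it would empty the register. *)
move=> z A B _ wBz x; suff -> : z = z1.
  case: x => [i|[]]; [by exists (inr true)|exists (inr false)|by exists (inr true)].
  exact: subK.
apply: contrapT => /eqP zz1; apply: nwB.
have : span (@colour T c v0) [ffun A => B A (+) B1 A] z.
  rewrite span_add; have := congr1 (@^~ z) wBz; have := congr1 (@^~ z) wBz1.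
  rewrite /wB /xorf /pointf eqxx (negbTE zz1).
  rewrite -/w0 -/v0.
  by case: (w0 z); case: (span _ B z); case: (span _ B1 z).
move=> /span_mem[A1 A1z]; exists (toggle B A1).
by rewrite /wB (span_toggle _ A1z) xorfA (wBz : xorf w0 (span (@colour T c v0) B) = _) xorff.
Qed.

Lemma orbit_bound_all T :
  exists I : finType, forall p, exists f : I -> state, orbit_bound None T p f.
Proof.
have level c : forall T', (forall g, g \in T' -> gbelow (Some c) g) ->
    exists I : finType, forall p, exists f : I -> state, orbit_bound (Some c) T' p f.
  by elim/(wf_ind wfTh): c => c IH; apply: orbit_bound_step => c' /= c'c; apply: IH.
by apply: orbit_bound_step => [c _|[//|[a kd]] //]; apply: level.
Qed.

Lemma tower_locally_finite : locally_finite (word_group actK).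
Proof.
apply: word_group_locally_finite => T; have [I IP] := orbit_bound_all T.
by exists I => p; have [f [fp _ fT]] := IP p; exists f.
Qed.

End Tower.

(** * Embedding a locally finite group *)

Section Encoding.
Variables (k : cardinal).
Hypothesis inf_k : infinite_set [set: k].

Lemma pairing_ex : exists f : k -> k -> k,
  forall x y x' y', f x y = f x' y' -> x = x' /\ y = y'.
Proof.
have [x0 _] := infinite_setN0 inf_k.
have := initial_square (@points_wf k) (@setT_down _ (points k)) (@points_initial k) inf_k.
move=> /(inj_card_leP x0)[f [_ finj]]; exists (fun x y => f (x, y)) => x y x' y' e.
by have [] := finj (x, y) (x', y') (conj I I) (conj I I) e.
Qed.

Lemma card_seq_le (A : Type) : [set: A] #<= [set: k] -> [set: seq A] #<= [set: k].
Proof.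
have /infiniteP nk := inf_k; have [x0 _] := infinite_setN0 inf_k.
have /(inj_card_leP x0)[n [_ ninj]] := nk.
have [pr prP] := pairing_ex; move=> /(inj_card_leP x0)[e [_ einj]].
pose code := fix code (w : seq A) : k := if w is a :: w' then
  pr (n 1%N) (pr (e a) (code w')) else pr (n 0%N) x0.
apply: (@card_le_inj _ _ _ _ code) => // w w' _ _.
elim: w w' => [|a w IH] [|a' w'] //= /prP[].
- by move=> /ninj -/(_ I I).
- by move=> /ninj -/(_ I I).
by move=> _ /prP[/einj -> // /IH ->].
Qed.

Lemma card_gen_le (Th L Bs : Type) m : [set: Th] #<= [set: k] ->
    [set: L] #<= [set: k] -> [set: Bs] #<= [set: k] ->
  [set: Bs + Th * kind m L] #<= [set: k].
Proof.
have /infiniteP nk := inf_k; have [x0 _] := infinite_setN0 inf_k.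
have /(inj_card_leP x0)[n [_ ninj]] := nk; have nI i j : n i = n j -> i = j by apply: ninj.
have [pr prP] := pairing_ex.
move=> /(inj_card_leP x0)[th [_ thI]] /(inj_card_leP x0)[l [_ lI]] /(inj_card_leP x0)[b [_ bI]].
pose kd (x : kind m L) : k := match x with
  | KE i z => pr (n 0%N) (pr (n i) (l z))
  | KB => pr (n 1%N) x0 | KH1 => pr (n 2%N) x0
  | KD => pr (n 3%N) x0 | KH2 => pr (n 4%N) x0 end.
have kdI : injective kd.
  by move=> [i z||||] [i' z'||||] //= /prP[/nI // _ /prP[/nI/val_inj -> /lI ->]].
pose code (g : Bs + Th * kind m L) : k := match g with
  | inl y => pr (n 0%N) (b y) | inr (c, x) => pr (n 1%N) (pr (th c) (kd x)) end.
apply: (@card_le_inj _ _ _ _ code) => // -[y|[c x]] [y'|[c' x']] _ _ //= /prP[/nI //].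
- by move=> _ /bI ->.
by move=> _ /prP[/thI -> // /kdI ->].
Qed.

Lemma card_prod_le (A B : Type) : [set: A] #<= [set: k] -> [set: B] #<= [set: k] ->
  [set: A * B] #<= [set: k].
Proof.
have [x0 _] := infinite_setN0 inf_k; have [pr prP] := pairing_ex.
move=> /(inj_card_leP x0)[a [_ aI]] /(inj_card_leP x0)[b [_ bI]].
apply: (@card_le_inj _ _ _ _ (fun e : A * B => pr (a e.1) (b e.2))) => //.
by move=> [x y] [x' y'] _ _ /= /prP[/aI -> // /bI ->].
Qed.

End Encoding.

Section Subgroups.
Local Open Scope group_scope.
Variable G : groupType.
Implicit Types (A : set G) (x y : G).

Lemma subgroup1 A : subgroup A -> A 1.
Proof. by move=> [A1 _]; move: A1; rewrite inE. Qed.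

Lemma subgroupD A x y : subgroup A -> A x -> A y -> A (x / y).
Proof.
by move=> [_ AD] Ax Ay; have := AD x y (mem_set Ax) (mem_set Ay); rewrite inE.
Qed.

Lemma subgroupV A x : subgroup A -> A x -> A (x^-1).
Proof. by move=> sA Ax; rewrite -[_^-1]mul1g; apply: subgroupD => //; apply: subgroup1. Qed.

Lemma subgroupM A x y : subgroup A -> A x -> A y -> A (x * y).
Proof. by move=> sA Ax Ay; rewrite -[y]invgK; apply: subgroupD => //; apply: subgroupV. Qed.

Lemma smallest_subgroup A : subgroup (smallest (@subgroup G) A).
Proof.
split=> [|x y]; first by rewrite inE => B [sB _]; apply: subgroup1.
rewrite !inE => Ax Ay B AB; apply: subgroupD; [exact: AB.1|exact: Ax|exact: Ay].
Qed.

End Subgroups.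

(** * Elements of finite order as products of involutions *)

Section TwistedShifts.
Local Open Scope nat_scope.
Variable G : groupType.

(* Interchange the residue classes [0] and [i] modulo [n], multiplying by [g] on
   the way up and by its inverse on the way down. *)
Definition twist (e : G * nat * nat) (y : G * nat) : G * nat :=
  let: (g, n, i) := e in
  if 0 < i < n then
    if y.2 %% n == 0 then ((g * y.1)%g, y.2 + i)
    else if y.2 %% n == i then ((g^-1 * y.1)%g, y.2 - i) else y
  else y.

Lemma modn_add_small x n i : i < n -> x %% n = 0 -> (x + i) %% n = i.
Proof. by move=> lin x0; rewrite -modnDml x0 add0n modn_small. Qed.

Lemma modn_sub_mod x n : (x - x %% n) %% n = 0.
Proof. by rewrite {1}(divn_eq x n) addnK modnMl. Qed.

Lemma twistK e : involutive (twist e).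
Proof.
move: e => [[g n] i] [y x]; rewrite /twist; case: (boolP (0 < i < n)) => // /andP[i0 lin] /=.
have [x0|nx0] := eqVneq (x %% n) 0.
  by rewrite /= modn_add_small // eqxx gtn_eqF // addnK mulgA mulVg mul1g.
have [xi|nxi] := eqVneq (x %% n) i; last by rewrite /= (negbTE nx0) (negbTE nxi).
have E : (x - i) %% n = 0 by rewrite -[in x - i]xi modn_sub_mod.
by rewrite /= E eqxx mulgA mulgV mul1g subnK // -xi leq_mod.
Qed.

Lemma twist_cycle g n i y x : 0 < i < n ->
  twist (g, n, i) (twist (1%g, n, i) (y, x)) =
    (if x %% n == 0 then (g^-1 * y)%g else if x %% n == i then (g * y)%g else y, x).
Proof.
move=> /[dup] lin /andP[i0 ltin]; rewrite /twist lin /=.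
have [x0|nx0] := eqVneq (x %% n) 0.
  by rewrite /= modn_add_small // gtn_eqF // eqxx addnK mul1g.
have [xi|nxi] := eqVneq (x %% n) i; last by rewrite /= (negbTE nx0) (negbTE nxi).
have E : (x - i) %% n = 0 by rewrite -[in x - i]xi modn_sub_mod.
by rewrite /= E eqxx invg1 mul1g subnK // -xi leq_mod.
Qed.

(* The twists spread [g] over the nonzero residues and collect [g^-(n-1) = g] on
   residue [0]. *)
Lemma twist_generate (g : G) n : 0 < n -> (g ^+ n)%g = 1%g ->
  exists w, forall y, word_act twist w y = ((g * y.1)%g, y.2).
Proof.
case: n => // n _ gn.
(* After [j] pairs of twists residue 0 carries [g ^- j] and residues 1 to [j] carry [g]; the modulus
   is [n.+1], so [j = n] exhausts the residues. *)
have spread j : j <= n -> exists w, forall y x, word_act twist w (y, x) =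
    ((if x %% n.+1 == 0 then g ^- j else if x %% n.+1 <= j then g else 1) * y, x)%g.
  elim: j => [_|j IH jn].
    exists [::] => y x /=; rewrite leqn0.
    by case: eqP => _; rewrite ?expg0 ?invg1 mul1g.
  have [w wP] := IH (ltnW jn).
  exists [:: (g, n.+1, j.+1), (1%g, n.+1, j.+1) & w] => y x.
  rewrite -[LHS]/(twist _ (twist _ (word_act twist w (y, x)))) wP twist_cycle ?ltnS //.
  congr (_, _).
  have [x0|nx0] := eqVneq; first by rewrite mulgA expgSr invgM.
  have [xj|nxj] := eqVneq (x %% n.+1) j.+1; first by rewrite xj ltnn leqnn mul1g.
  by rewrite [in RHS]leq_eqVlt (negbTE nxj) /= ltnS.
have [w wP] := spread n (leqnn n).
exists w => -[y x] /=; rewrite wP; congr (_, _).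
rewrite -ltnS ltn_mod /=; case: ifP => // _; congr (_ * _)%g.
by apply: mulg1_eq; rewrite -expgSr.
Qed.

Lemma finite_order (g : G) : locally_finite G -> exists2 n, 0 < n & (g ^+ n)%g = 1%g.
Proof.
move=> /(_ [set g] (finite_set1 _)) fin; apply: contrapT => nex.
set K := smallest _ _ in fin.
have gK n : K (g ^+ n)%g.
  elim: n => [|n IH]; first exact: (subgroup1 (smallest_subgroup _)).
  by rewrite expgS; apply: (subgroupM (smallest_subgroup _) _ IH); apply: sub_gen_smallest.
apply: infinite_nat; apply: card_le_finite fin.
apply: (@card_le_inj _ _ _ _ (fun n => g ^+ n)%g) => // m n _ _.
wlog mn : m n / m <= n.
  by move=> H; case: (leqP m n) => [/H //|/ltnW/H h /esym/h].
move=> gmn; apply: contrapT => nmn; apply: nex; exists (n - m).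
  by rewrite subn_gt0 ltn_neqAle mn andbT; apply/eqP.
by rewrite expgnFr // gmn mulgV.
Qed.

(** An orbit stays in [K y] times a block of length [N]: [K] is the finite subgroup generated by the
    group entries of [T], and [N] is a common multiple of the positive moduli, a twist of modulus 0
    being trivial. *)
Lemma twist_bounded (T : seq (G * nat * nat)) : locally_finite G ->
  exists I : finType, forall y, exists f : I -> G * nat,
    (exists i, f i = y) /\ forall e, e \in T -> forall i, exists j, twist e (f i) = f j.
Proof.
move=> lfG; pose gs := map (fun e : G * nat * nat => e.1.1) T.
set K := smallest (@subgroup G) [set` gs].
have /finite_seqP[ks KE] : finite_set K by apply: lfG; apply: finite_seq.
have sK : subgroup K := smallest_subgroup _.
pose N := \prod_(e <- T | 0 < e.1.2) e.1.2.
have N0 : 0 < N by apply: prodn_cond_gt0.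
have dvdN e : e \in T -> 0 < e.1.2 -> e.1.2 %| N.
  by move=> eT e0; rewrite /N (big_rem e) //= e0 dvdn_mulr.
exists ('I_(size ks) * 'I_N)%type => -[y x].
pose f (i : 'I_(size ks) * 'I_N) := ((nth 1 ks i.1 * y)%g, (x %/ N * N + i.2)%N).
have inf k r : K k -> r < N -> exists i, f i = ((k * y)%g, (x %/ N * N + r)%N).
  move=> Kk rN; have kks : k \in ks by move: Kk; rewrite KE.
  have ki : index k ks < size ks by rewrite index_mem.
  by exists (Ordinal ki, Ordinal rN); rewrite /f /= nth_index.
exists f; split.
  have [|i fi] := inf 1%g (x %% N) (subgroup1 sK); first by rewrite ltn_mod.
  by exists i; rewrite fi mul1g -divn_eq.
move=> [[g n] i] eT [[ki kiP] [r rN]]; rewrite /f /=.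
have Kk : K (nth 1 ks ki)%g by rewrite KE /=; apply: mem_nth.
have Kg : K g.
  by move=> A [_ gA]; apply: gA => /=; apply/mapP; exists (g, n, i).
case: (boolP (0 < i < n)) => [/andP[i0 lin]|_]; last by have [j <-] := inf _ r Kk rN; exists j.
have n0 := ltn_trans i0 lin; have nN := dvdN _ eT n0.
have modE : (x %/ N * N + r) %% n = r %% n.
  by rewrite -modnDml -modnMmr (eqP nN) muln0 mod0n add0n.
rewrite modE; have [r0|nr0] := eqVneq (r %% n) 0.
  have rin : r + i < N.
    have /dvdnP[q Nq] := nN; have /dvdnP[q' rq] : n %| r by apply/eqP.
    move: rN; rewrite Nq rq ltn_mul2r => /andP[_ qq].
    apply: leq_trans (_ : q'.+1 * n <= _); first by rewrite mulSn addnC ltn_add2r.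
    by rewrite leq_mul2r qq orbT.
  by rewrite -addnA mulgA; have [j <-] := inf _ _ (subgroupM sK Kg Kk) rin; exists j.
have [ri|nri] := eqVneq (r %% n) i; last by have [j <-] := inf _ r Kk rN; exists j.
have ir : i <= r by rewrite -ri leq_mod.
rewrite -addnBA // mulgA.
have [|j <-] := inf _ (r - i) (subgroupM sK (subgroupV sK Kg) Kk); last by exists j.
exact: leq_ltn_trans (leq_subr _ _) rN.
Qed.

End TwistedShifts.

Section GroupTower.
Variables (lambda theta : cardinal) (G : groupType).
Hypothesis lfG : locally_finite G.
Variables (k : nat) (O : ('I_k -> lambda) -> lambda).

Local Notation Th := (points theta).
Local Notation Bs := (G * nat * nat)%type.
Local Notation gens := (@gen _ Th lambda k Bs).
Local Notation states := (@state _ Th lambda k (G * nat)%type).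

Variable s : lambda -> gens.
Hypothesis s_surj : forall g, exists x, s x = g.

Local Notation tact := (act (@points_wf theta) O (@twist G) s).
Definition tower := word_group (actK (@points_wf theta) O (@twistK G) s).

Lemma tower_lf : locally_finite tower.
Proof.
apply: tower_locally_finite => T.
have [I IP] := twist_bounded (pmap (fun g : gens => if g is inl e then Some e else None) T) lfG.
exists I => y; have [f [fy fP]] := IP y; exists f; split=> // e eT.
by apply: fP; rewrite mem_pmap; apply/mapP; exists (inl e).
Qed.

Definition all_quiet (p : states) := forall c, quiet (p.2 c).

Definition base_fun (h : G * nat -> G * nat) (p : states) : states :=
  if `[< all_quiet p >] then (h p.1, p.2) else p.

Lemma act_base e : tact (inl e) = base_fun (twist e).
Proof.
apply/funext => p; rewrite /base_fun; case: asboolP => [q|nq].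
  by rewrite /act subE //; split=> // c _ _; apply: q.
by apply: sub_id => -[_ h]; apply: nq => c; apply: h.
Qed.

Lemma word_base w : word_act tact (map inl w) = base_fun (word_act (@twist G) w).
Proof.
elim: w => [|e w IH]; apply/funext => p /=; first by rewrite /base_fun; case: ifP => //; case: p.
rewrite IH act_base {2}/base_fun; case: asboolP => [q|nq]; last by rewrite /base_fun !asboolF.
by rewrite /base_fun !asboolT.
Qed.

Definition translate (g : G) := base_fun (fun y => (g * y.1, y.2)%g).

(** Local finiteness gives [g] finite order, so the translation is a product of twists. *)
Lemma translate_word g : exists w, translate g = word_act tact w.
Proof.
have [n n0 gn] := finite_order g lfG; have [w wP] := twist_generate n0 gn.
exists (map inl w); rewrite word_base /translate; congr base_fun.
by apply/funext => y; rewrite wP.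
Qed.

Definition embed (g : G) : tower := WordMap (translate_word g).

Lemma embedM : {morph embed : g h / (g * h)%g}.
Proof.
move=> g h; apply: word_map_inj; apply/funext => p; rewrite word_groupM /= /translate /base_fun.
by case: asboolP => [q|nq] /=; rewrite ?(asboolT q) ?(asboolF nq) //= mulgA.
Qed.

Lemma embed_inj : injective embed.
Proof.
move=> g h /(congr1 (@word_fun _ _ _)) /= /(congr1 (@^~ ((1%g, 0%N), fun=> (@zerof _, @zerof _, false)))).
by rewrite /translate /base_fun /= asboolT //= !mulg1 => -[].
Qed.

Definition letter (g : gens) : tower := word_of tact [:: g].

Lemma letters_generate (A : set tower) : subgroup A -> (forall g, A (letter g)) -> A = [set: tower].
Proof.
move=> sA lA; apply/seteqP; split=> // h _; have [w ->] := word_ofP h.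
elim: w => [|g w IH]; first by have := subgroup1 sA; congr A; apply: word_map_inj.
by have := subgroupM sA (lA g) IH; congr A; apply: word_map_inj.
Qed.

Lemma letter_generated (A : set tower) c t : subgroup A ->
    (forall m, A (letter (inr (c, KE m (t m))))) ->
    A (letter (inr (c, KB))) -> A (letter (inr (c, KH1))) ->
    A (letter (inr (c, KD))) -> A (letter (inr (c, KH2))) ->
    gbelow (Some c) (s (O t)) ->
  A (letter (s (O t))).
Proof.
move=> sA AE AB AH1 AD AH2 sc.
pose M : set (states -> states) := [set f | exists2 h : tower, A h & word_fun h = f].
have letterE g : word_fun (letter g) = tact g by [].
have [||m|||||h Ah hE] := @act_generated _ _ (@points_wf theta) _ _ O _ _ _ (@twistK G) s M
  _ _ c t _ _ _ _ _ sc.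
- by exists 1%g; first exact: subgroup1.
- by move=> f g [h Ah <-] [h' Ah' <-]; exists (h * h')%g => //; apply: subgroupM.
- by exists (letter (inr (c, KE m (t m)))).
- by exists (letter (inr (c, KB))).
- by exists (letter (inr (c, KH1))).
- by exists (letter (inr (c, KD))).
- by exists (letter (inr (c, KH2))).
by have -> : letter (s (O t)) = h by apply: word_map_inj; rewrite hE.
Qed.

(** * Indecomposability of the tower *)

Section Chain.
Variables (sigma : cardinal) (M : sigma -> set tower).
Hypothesis reg_theta : regular theta.
Hypothesis reg_sigma : regular sigma.
Hypothesis sigma_theta : ~ ([set: sigma] #= [set: theta]).
Hypothesis O_onto : forall u : sigma -> set lambda,
  (forall i j, cardinal_le i j -> u i `<=` u j) -> (forall x, exists i, u i x) ->
  exists i, forall x, exists2 t, (forall m, u i (t m)) & O t = x.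
Hypothesis sM : forall i, subgroup (M i).
Hypothesis M_mono : forall i j, cardinal_le i j -> M i `<=` M j.
Hypothesis M_cover : forall h, exists i, M i h.

Lemma chain_seq (hs : seq tower) : exists i, forall h, h \in hs -> M i h.
Proof.
elim: hs => [|h hs [i iP]]; first by have [i _] := M_cover 1%g; exists i.
have [j Mj] := M_cover h.
have [ij|ji] := orP (cardinal_le_total (i : points sigma) j).
  by exists j => h'; rewrite inE => /orP[/eqP -> //|/iP]; apply: M_mono.
by exists i => h'; rewrite inE => /orP[/eqP ->|/iP //]; apply: (M_mono ji).
Qed.

(** [O_onto] applies to the sets of those [x] whose letters [KE m x] at level [c] all lie in [M i];
    every letter below [c] is some [s (O t)] with [t] in one such set. *)
Lemma chain_level c : exists i, forall g : gens, gbelow (Some c) g -> M i (letter g).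
Proof.
pose shifts_at x := [seq letter (inr (c, KE m x)) | m : 'I_k].
pose switches := [:: letter (inr (c, KB)); letter (inr (c, KH1));
                     letter (inr (c, KD)); letter (inr (c, KH2))].
have [|x|i iP] := O_onto (u := fun i => [set x | forall h, h \in shifts_at x -> M i h]).
- by move=> i j ij x ix h /ix; apply: M_mono.
- exact: chain_seq.
have [j jP] := chain_seq switches.
have [l il jl] : exists2 l, cardinal_le i l & cardinal_le j l.
  have [ij|ji] := orP (cardinal_le_total (i : points sigma) j).
    by exists j => //; apply: cardinal_le_refl.
  by exists i => //; apply: cardinal_le_refl.
exists l => g gc; have [x sx] := s_surj g; have [t tP Ot] := iP x.
have sOt : s (O t) = g by rewrite Ot.
rewrite -sOt; apply: (@letter_generated _ c t (sM l)); last by rewrite sOt.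
- by move=> m; apply: (M_mono il); apply: tP; apply: map_f; rewrite mem_enum.
- by apply: (M_mono jl); apply: jP; rewrite !inE eqxx.
- by apply: (M_mono jl); apply: jP; rewrite !inE eqxx ?orbT.
- by apply: (M_mono jl); apply: jP; rewrite !inE eqxx ?orbT.
- by apply: (M_mono jl); apply: jP; rewrite !inE eqxx ?orbT.
Qed.

(** Each level is captured by some [M i]. As [sigma] is not the cofinality of [theta], one [M i]
    captures unboundedly many levels, hence all letters. *)
Lemma chain_stops : exists i, M i = [set: tower].
Proof.
pose D i : set (points theta) := [set c | forall g : gens, gbelow (Some c) g -> M i (letter g)].
have [i unb] : exists i, forall c : points theta, exists2 c', D i c' & c < c'.
  apply: contrapT => nunb; apply: sigma_theta; apply: (@cofinality_unique _ _ theta); last by case: reg_theta.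
  apply: (@cofinal_chain sigma theta D) => //; first by case: reg_theta.
  - by move=> i j ij c Dc g /Dc; apply: M_mono.
  - exact: chain_level.
  move=> i; apply: contrapT => nb; apply: nunb; exists i => c; apply: contrapT => nc.
  by apply: nb; exists c => c' Dc'; rewrite leNgt; apply/negP => cc'; apply: nc; exists c'.
exists i; apply: letters_generate => // -[e|[c kd]].
  have [c0 _] := infinite_setN0 reg_theta.1.
  by have [c Dc _] := unb c0; apply: Dc.
by have [c' Dc' cc'] := unb c; apply: Dc'.
Qed.

End Chain.
End GroupTower.

Theorem mainTheorem7 (lambda theta : cardinal)
    (lambda_uncountable : ~ countable [set: lambda])
    (theta_regular : regular theta)
    (theta_le_lambda : [set: theta] #<= [set: lambda])
    (G : groupType)
    (G_locally_finite : locally_finite G)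
    (card_G : [set: G] #= [set: lambda]) :
  exists (H : groupType) (f : {multiplicative G -> H}),
    [/\ injective f,
        locally_finite H,
        [set: H] #= [set: lambda]
      & set_indecomposable
          (fun sigma => Theta' lambda sigma /\ ~ Theta lambda theta sigma) H].
Proof.
have inf : infinite_set [set: lambda].
  by move=> fin; apply: lambda_uncountable; apply: finite_set_countable.
have [O OP] := indecomposable_operation inf.
have /card_eqPle[Gle leG] := card_G.
have nat_le : [set: nat] #<= [set: lambda] by apply/infiniteP.
have gens_le : [set: @gen _ (points theta) lambda 6 (G * nat * nat)] #<= [set: lambda].
  by apply: card_gen_le => //; do 2!apply: card_prod_le => //.
have [x0 _] := infinite_setN0 inf.
have /(inj_card_leP x0)[e [_ e_inj]] := gens_le.
(* [s] inverts [e] on its range and is an arbitrary letter off it. *)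
have /choice[s sP] : forall x, exists g, forall g', e g' = x -> g' = g.
  move=> x; have [[g gx]|nx] := pselect (exists g, e g = x).
    by exists g => g' g'x; apply: e_inj => //; rewrite gx.
  by exists (inl (1%g, 0%N, 0%N)) => g' g'x; case: nx; exists g'.
have s_surj g : exists x, s x = g by exists (e g); rewrite -(sP (e g) g).
pose H := @tower lambda theta G 6 O s.
pose f0 : G -> H := @embed lambda theta G G_locally_finite 6 O s.
have f0M : {morph f0 : g h / (g * h)%g} by apply: embedM.
pose f : {multiplicative G -> H} := HB.pack f0 (isMultiplicative.Build G H f0 f0M).
have f_inj : injective f by apply: embed_inj.
exists H, f; split=> //.
- exact: tower_lf.
- apply: Cantor_Bernstein; last first.
    by apply: card_le_trans leG _; apply: (@card_le_inj _ _ _ _ f) => // g h _ _ /f_inj.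
  have /choice[w wP] := @word_ofP _ _ (act (@points_wf theta) O (@twist G) s).
  apply: card_le_trans (card_seq_le inf gens_le).
  by apply: (@card_le_inj _ _ _ _ w) => // h h' _ _ hh'; rewrite (wP h) (wP h') hh'.
move=> sigma [[lt reg _] nTheta] M sM mono cover.
apply: (chain_stops s_surj theta_regular reg _ _ sM mono).
- by move=> st; apply: nTheta; constructor 2.
- by move=> u umono ucover; apply: (OP sigma) => // h; apply: nTheta; [constructor 1|constructor 3].
move=> h; have : (\bigcup_i M i) h by rewrite cover.
by case=> i _ Mi; exists i.
Qed.
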